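(* Let $\mathcal{X},\mathcal{Y}$ be complex Banach spaces, $A\in B(\mathcal{X})$, $B\in B(\mathcal{Y})$ with $\sigma(A)\cap\sigma(B)=\emptyset$, let $C:\mathcal{Y}\to\mathcal{X}$ be a bounded operator, and let $$M=\begin{pmatrix}A&C\\0&B\end{pmatrix}$$ act on $\mathcal{X}\oplus\mathcal{Y}$. Let $0<\varepsilon<\operatorname{dist}(\sigma(A),\sigma(B))/2$ and let $r=p/q$ be a rational function such that $p$ has distinct roots, $\deg q<\deg p$, and the connected components of $V=\{z\in\mathbb{C}:|r(z)|<1\}$ can be grouped into three disjoint sets $V=V_1\cup V_2\cup V_0$ with $\sigma(A)\Subset V_1$, $\sigma(B)\Subset V_2$, $V_0\cap\sigma(M)=\emptyset$ ($V_0$ possibly empty), and $\operatorname{dist}(V_i,V_j)\ge\varepsilon/2$ for $i\ne j$. Let $\psi:V\to\mathbb{C}$ be the holomorphic function with $\psi=1$ in $V_1$, $\psi=-1$ in $V_2$ and $\psi=0$ in $V_0$. Then the upper right corner element of $\psi(M)$ is $2X$, where $X:\mathcal{Y}\to\mathcal{X}$ is the solution of the Sylvester equation $AX-XB=C$.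
   Context: $\sigma(\cdot)$ denotes the spectrum. A rational function is written $r=p/q$ with complex polynomials $p,q$ having no common roots; at a pole $|r(z)|=\infty$. The notation $S\Subset V$ means that the compact set $S$ is contained in the interior of $V$; the distance to the empty set is $+\infty$. When $\sigma(A)\cap\sigma(B)=\emptyset$ the equation $AX-XB=C$ has exactly one bounded solution $X$ for every bounded $C$. The operator $\psi(M)$ is defined by the holomorphic functional calculus and written as a $2\times2$ operator block matrix on $\mathcal{X}\oplus\mathcal{Y}$. (In the paper $\psi$ is represented as $\psi(z)=\sum_{j=1}^d\delta_j(z)h_j(r(z))$, where $\lambda_1,\dots,\lambda_d$ are the roots of $p$, $\delta_j(z)=\frac{r(z)}{r'(\lambda_j)(z-\lambda_j)}$, and the $h_j$ are holomorphic for $|w|<1$ with power series $h_j(w)=\sum_{k\ge0}h_{j,k}w^k$.) *)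

(* Defs.v *)
(* Stdlib reals with Coquelicot.  A complex Banach space is a
   [CompleteNormedModule C_AbsRing], and Coquelicot's [is_linear] means
   "linear and bounded". *)
From Stdlib Require Import Reals List ClassicalEpsilon.
From Coquelicot Require Import Coquelicot.

Set Implicit Arguments.
Unset Strict Implicit.
Unset Printing Implicit Defensive.

(* Coquelicot only integrates functions with values in a module over the real
   numbers, and has no completeness instance for products. *)

Section Realify.

Variable V : CompleteNormedModule C_AbsRing.

Let rscal (x : R) (v : V) : V := scal (RtoC x : C_AbsRing) v.

Lemma realify_scal_assoc (x y : R_AbsRing) (u : V) :
  rscal x (rscal y u) = rscal (mult x y) u.
Proof.
  unfold rscal; rewrite scal_assoc; f_equal.
  now change (mult (RtoC x : C_AbsRing) (RtoC y)) with (Cmult x y);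
    rewrite <- RtoC_mult.
Qed.

Lemma realify_scal_one (u : V) : rscal (one : R_AbsRing) u = u.
Proof. exact (scal_one u). Qed.

Lemma realify_scal_distr_l (x : R_AbsRing) (u v : V) :
  rscal x (plus u v) = plus (rscal x u) (rscal x v).
Proof. exact (scal_distr_l (RtoC x : C_AbsRing) u v). Qed.

Lemma realify_scal_distr_r (x y : R_AbsRing) (u : V) :
  rscal (plus x y) u = plus (rscal x u) (rscal y u).
Proof.
  unfold rscal; transitivity (scal (plus (RtoC x : C_AbsRing) (RtoC y)) u).
  - f_equal; exact (RtoC_plus x y).
  - exact (scal_distr_r (RtoC x : C_AbsRing) (RtoC y) u).
Qed.

Definition realify_ModuleSpace_mixin :
    ModuleSpace.mixin_of R_AbsRing (CompleteNormedModule.AbelianGroup _ V) :=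
  ModuleSpace.Mixin R_AbsRing (CompleteNormedModule.AbelianGroup _ V) rscal
    realify_scal_assoc realify_scal_one
    realify_scal_distr_l realify_scal_distr_r.

Definition realify_NormedModuleAux : NormedModuleAux R_AbsRing :=
  NormedModuleAux.Pack R_AbsRing V
    (NormedModuleAux.Class R_AbsRing V
       (ModuleSpace.Class R_AbsRing V
          (AbelianGroup.class (CompleteNormedModule.AbelianGroup _ V))
          realify_ModuleSpace_mixin)
       (UniformSpace.class (CompleteNormedModule.UniformSpace _ V))) V.

Lemma realify_norm_scal (x : R_AbsRing) (v : V) :
  norm (rscal x v) <= abs x * norm v.
Proof.
  apply Rle_trans with (1 := norm_scal (RtoC x : C_AbsRing) v).
  change (abs (RtoC x : C_AbsRing)) with (Cmod (RtoC x)).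
  rewrite Cmod_R; apply Rle_refl.
Qed.

Definition realify_NormedModule_mixin :
    NormedModule.mixin_of R_AbsRing realify_NormedModuleAux :=
  NormedModule.Mixin R_AbsRing realify_NormedModuleAux
    (fun v : V => norm v) (@norm_factor _ V)
    (fun x y : V => norm_triangle x y) realify_norm_scal
    (fun x y : V => @norm_compat1 _ V x y)
    (fun x y : V => @norm_compat2 _ V x y)
    (fun x : V => @norm_eq_zero _ V x).

Definition realify : CompleteNormedModule R_AbsRing :=
  CompleteNormedModule.Pack R_AbsRing V
    (CompleteNormedModule.Class R_AbsRing V
       (NormedModule.Class R_AbsRing V _ realify_NormedModule_mixin)
       (CompleteSpace.class (CompleteNormedModule.CompleteSpace _ V))) V.

End Realify.

Section DirectSum.

Variables U V : CompleteNormedModule C_AbsRing.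

Let Z : UniformSpace := prod_UniformSpace U V.

Definition prod_lim (F : (Z -> Prop) -> Prop) : Z :=
  (lim (fun P : U -> Prop => F (fun z => P (fst z))),
   lim (fun P : V -> Prop => F (fun z => P (snd z)))).

Lemma prod_complete (F : (Z -> Prop) -> Prop) :
  ProperFilter F -> cauchy F ->
  forall eps : posreal, F (ball (prod_lim F) eps).
Proof.
  intros HF Hc eps; apply filter_and.
  - apply (complete_cauchy (fun P : U -> Prop => F (fun z => P (fst z)))).
    + exact (filtermap_proper_filter _ _ fst F HF).
    + intros e; destruct (Hc e) as [z Hz]; exists (fst z).
      revert Hz; apply filter_imp; intros w [H _]; exact H.
  - apply (complete_cauchy (fun P : V -> Prop => F (fun z => P (snd z)))).
    + exact (filtermap_proper_filter _ _ snd F HF).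
    + intros e; destruct (Hc e) as [z Hz]; exists (snd z).
      revert Hz; apply filter_imp; intros w [_ H]; exact H.
Qed.

Lemma prod_close_lim (F1 F2 : (Z -> Prop) -> Prop) :
  filter_le F1 F2 -> filter_le F2 F1 -> close (prod_lim F1) (prod_lim F2).
Proof.
  intros H1 H2 eps; split.
  - apply (close_lim (fun P : U -> Prop => F1 (fun z => P (fst z)))
                     (fun P : U -> Prop => F2 (fun z => P (fst z))));
      intros P; [apply H1 | apply H2].
  - apply (close_lim (fun P : V -> Prop => F1 (fun z => P (snd z)))
                     (fun P : V -> Prop => F2 (fun z => P (snd z))));
      intros P; [apply H1 | apply H2].
Qed.

Definition direct_sum : CompleteNormedModule C_AbsRing :=
  CompleteNormedModule.Pack C_AbsRing (U * V)
    (CompleteNormedModule.Class C_AbsRing (U * V)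
       (NormedModule.class C_AbsRing (prod_NormedModule C_AbsRing U V))
       (CompleteSpace.Mixin Z prod_lim prod_complete prod_close_lim)) (U * V).

End DirectSum.

Section Operators.

Variables X Y : CompleteNormedModule C_AbsRing.

Definition upper_triangular (A : X -> X) (C0 : Y -> X) (B : Y -> Y)
    (v : direct_sum X Y) : direct_sum X Y :=
  (plus (A (fst v)) (C0 (snd v)), B (snd v)).

Definition upper_right_corner
    (T : direct_sum X Y -> direct_sum X Y) (y : Y) : X :=
  fst (T (zero, y)).

Definition sylvester_solution
    (A : X -> X) (B : Y -> Y) (C0 : Y -> X) (S : Y -> X) : Prop :=
  is_linear S /\ forall y, minus (A (S y)) (S (B y)) = C0 y.

End Operators.

Section Spectrum.

Variable Z : CompleteNormedModule C_AbsRing.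

Definition is_resolvent (M : Z -> Z) (z : C_AbsRing) (S : Z -> Z) : Prop :=
  is_linear S /\
  (forall v, S (minus (scal z v) (M v)) = v) /\
  (forall v, minus (scal z (S v)) (M (S v)) = v).

Definition spectrum (M : Z -> Z) (z : C) : Prop :=
  ~ exists S, is_resolvent M z S.

(* (z - M)^-1, meaningful for z outside the spectrum only *)
Definition resolvent (M : Z -> Z) (z : C) : Z -> Z :=
  epsilon (inhabits (fun v => v)) (is_resolvent M z).

End Spectrum.

(* Infimum of |z - w|; it is +oo when S or T is empty. *)
Definition set_dist (S T : C -> Prop) : Rbar :=
  Glb_Rbar (fun d => exists z w : C, S z /\ T w /\ d = Cmod (z - w)).

(* To be used for compact S. *)
Definition inside_interior (S V : C -> Prop) : Prop :=
  forall z : C, S z -> locally z V.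

Definition connected (S : C -> Prop) : Prop :=
  forall U W : C -> Prop,
    open U -> open W ->
    (forall z, S z -> U z \/ W z) ->
    (forall z, S z -> ~ (U z /\ W z)) ->
    (exists z, S z /\ U z) -> (exists z, S z /\ W z) -> False.

Definition same_component (V : C -> Prop) (z w : C) : Prop :=
  exists S : C -> Prop,
    connected S /\ (forall u, S u -> V u) /\ S z /\ S w.

Definition union_of_components (V W : C -> Prop) : Prop :=
  (forall z, W z -> V z) /\
  (forall z w, W z -> same_component V z w -> W w).

Definition holomorphic_on (V : C -> Prop) (f : C -> C) : Prop :=
  forall z : C, V z -> @ex_derive C_AbsRing C_NormedModule f z.

(* Nonzero polynomials. *)
Record cpoly := CPoly {
  deg : nat;
  coef : nat -> C;
  lead_neq0 : coef deg <> RtoC 0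
}.

Definition peval (p : cpoly) (z : C) : C :=
  sum_n (fun k => (coef p k * Cpow z k)%C) (deg p).

Definition has_distinct_roots (p : cpoly) : Prop :=
  exists l : list C, NoDup l /\ length l = deg p /\
    forall z, In z l -> peval p z = RtoC 0.

Definition no_common_root (p q : cpoly) : Prop :=
  forall z, ~ (peval p z = RtoC 0 /\ peval q z = RtoC 0).

(* Poles are excluded explicitly: |r| is infinite there, whereas division by
   zero is total in Coquelicot. *)
Definition sublevel1 (p q : cpoly) (z : C) : Prop :=
  peval q z <> RtoC 0 /\ Cmod (peval p z / peval q z) < 1.

(* An arc is the restriction to [0,1] of a map which is C^1 around each point
   of [0,1]; this is no loss of generality, since every C^1 map on [0,1]
   extends to R.  A closed piecewise C^1 path is a list of consecutive arcs. *)

Definition velocity (g : R -> C) (t : R) : C :=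
  (Derive (fun s => fst (g s)) t, Derive (fun s => snd (g s)) t).

Definition C1_arc (g : R -> C) : Prop :=
  forall t, 0 <= t <= 1 ->
    @ex_derive R_AbsRing C_R_NormedModule g t /\ continuous (velocity g) t.

Fixpoint joins (z : C) (path : list (R -> C)) (w : C) : Prop :=
  match path with
  | nil => z = w
  | g :: path' => g 0 = z /\ joins (g 1) path' w
  end.

Definition closed_path (path : list (R -> C)) : Prop :=
  (exists z, joins z path z) /\ List.Forall C1_arc path.

(* A cycle is a formal sum of closed paths. *)
Definition cycle (G : list (list (R -> C))) : Prop := List.Forall closed_path G.

Definition on_cycle (G : list (list (R -> C))) (z : C) : Prop :=
  exists g t, In g (concat G) /\ 0 <= t <= 1 /\ z = g t.

Definition arc_integral (V : CompleteNormedModule C_AbsRing)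
    (g : R -> C) (f : C -> V) : V :=
  @RInt (realify V)
    (fun t => scal (velocity g t : C_AbsRing) (f (g t))) 0 1.

Definition cycle_integral (V : CompleteNormedModule C_AbsRing)
    (G : list (list (R -> C))) (f : C -> V) : V :=
  fold_right (fun g s => plus (arc_integral g f) s) zero (concat G).

Definition winding_number (G : list (list (R -> C))) (a : C) : C :=
  (cycle_integral (V := C_CompleteNormedModule) G (fun z => / (z - a)) /
   (RtoC (2 * PI) * Ci))%C.

(* G is a cycle in Om that surrounds the set K once and does not wind around
   any point outside Om. *)
Definition surrounds (G : list (list (R -> C))) (K Om : C -> Prop) : Prop :=
  cycle G /\
  (forall z, on_cycle G z -> Om z /\ ~ K z) /\
  (forall z, K z -> winding_number G z = RtoC 1) /\
  (forall z, ~ Om z -> winding_number G z = RtoC 0).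

(* T = f(M) in the sense of Riesz and Dunford, for f holomorphic on the open
   neighbourhood Om of the spectrum of M:
     f(M) v = (1 / 2 pi i) \oint_G f(z) (z - M)^-1 v dz.
   The value does not depend on the cycle. *)
Definition is_functional_calculus (Z : CompleteNormedModule C_AbsRing)
    (Om : C -> Prop) (f : C -> C) (M T : Z -> Z) : Prop :=
  exists G, surrounds G (spectrum M) Om /\
    forall v, T v =
      scal (/ (RtoC (2 * PI) * Ci) : C_AbsRing)%C
        (cycle_integral G
           (fun z => scal (f z : C_AbsRing) (resolvent M z v))).

(* Main.v *)
Require Import Defs.
From Stdlib Require Import Reals Lra Lia List Classical ClassicalEpsilon ssreflect.
From Coquelicot Require Import Coquelicot.

Set Implicit Arguments.
Unset Strict Implicit.
Unset Printing Implicit Defensive.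

Local Open Scope R_scope.

(** The change of basis [(x, y) |-> (x + S y, y)] turns the block operator [M]
    into the diagonal operator with entries [A] and [B], precisely because
    [A S - S B = C0].  Hence the upper right corner of [(z - M)^-1] is
    [(z - A)^-1 S - S (z - B)^-1] ([block_resolvent_corner]), and that of
    [psi(M)] is [psi(A) S - S psi(B)].  Since [psi] is [1] near the spectrum of
    [A] and [-1] near the spectrum of [B], one expects [psi(A) = 1] and
    [psi(B) = -1], which gives [2 S].

    The work lies in these two equalities, because the cycle [G] which defines
    [psi(M)] is arbitrary: it surrounds the spectrum in the sense of winding
    numbers only, and may run through every piece of the domain.  They are
    obtained from Liouville's theorem for functions with values in a Banach
    space ([liouville]), applied twice.

    - [riesz_integral].  Let [u = c x - \oint psi(z) (z - A)^-1 x dz].  The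
      resolvent identity shows that, near the spectrum of [A], [(w - A)^-1 u]
      coincides with the Cauchy integral
      [\oint psi(z) (z - A)^-1 x / (z - w) dz], provided that
      [\oint psi(z) / (z - w) dz = c] there.  The Cauchy integral is holomorphic
      across the spectrum, so the local resolvent [(w - A)^-1 u] extends to an
      entire function which tends to [0] at infinity; it vanishes, and so does
      [u].

    - [separated_index].  It remains to compute [\oint psi(z) / (z - w) dz].
      Inside the domain, [psi] is a combination of the constant [1] and of the
      indicator functions of the three pieces, so it is enough to see that the
      part of the cycle lying in one piece does not wind around the points of
      the other pieces.  The index of that part, considered away from its piece,
      and minus the index of the rest of the cycle, considered near that piece,
      agree where both make sense, as the whole cycle has index [0] outside the
      domain.  They form an entire function which tends to [0] at infinity.

    Liouville's theorem is used for functions having at each point a second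
    order Taylor expansion ([taylor2]); Cauchy integrals and resolvents are
    seen to have one by algebraic identities. *)

(** * Linear combinations of vectors *)

Section ModuleNormalization.

Variable V : CompleteNormedModule C_AbsRing.

Inductive mexp :=
| MAtom (n : nat)
| MZero
| MPlus (a b : mexp)
| MOpp (a : mexp)
| MScal (c : C) (a : mexp).

Fixpoint mden (l : list V) (e : mexp) : V :=
  match e with
  | MAtom n => nth n l zero
  | MZero => zero
  | MPlus a b => plus (mden l a) (mden l b)
  | MOpp a => opp (mden l a)
  | MScal c a => scal (c : C_AbsRing) (mden l a)
  end.

Fixpoint mcoef (e : mexp) (i : nat) : C :=
  match e with
  | MAtom n => if Nat.eqb n i then RtoC 1 else RtoC 0
  | MZero => RtoC 0
  | MPlus a b => (mcoef a i + mcoef b i)%C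
  | MOpp a => (- mcoef a i)%C
  | MScal c a => (c * mcoef a i)%C
  end.

Fixpoint mcomb (l : list V) (f : nat -> C) : V :=
  match l with
  | nil => zero
  | v :: l' => plus (scal (f O : C_AbsRing) v) (mcomb l' (fun i => f (S i)))
  end.

Fixpoint meq (n : nat) (f g : nat -> C) : Prop :=
  match n with
  | O => True
  | S n' => f O = g O /\ meq n' (fun i => f (S i)) (fun i => g (S i))
  end.

Lemma mcomb_ext l f g : meq (length l) f g -> mcomb l f = mcomb l g.
Proof.
  revert f g; induction l as [|v l IH]; intros f g H; [reflexivity|].
  destruct H as [H0 H1]; simpl; rewrite H0 (IH _ _ H1); reflexivity.
Qed.

Lemma mcomb_zero l : mcomb l (fun _ => RtoC 0) = zero.
Proof.
  induction l as [|v l IH]; [reflexivity|]; simpl; rewrite IH plus_zero_r.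
  exact (scal_zero_l (K := C_AbsRing) v).
Qed.

Lemma mcomb_plus l f g :
  mcomb l (fun i => f i + g i)%C = plus (mcomb l f) (mcomb l g).
Proof.
  revert f g; induction l as [|v l IH]; intros f g; simpl.
  - now rewrite plus_zero_l.
  - rewrite (IH (fun i => f (S i)) (fun i => g (S i))).
    replace (scal ((f O + g O)%C : C_AbsRing) v)
      with (plus (scal (f O : C_AbsRing) v) (scal (g O : C_AbsRing) v))
      by exact (eq_sym (scal_distr_r (f O : C_AbsRing) (g O) v)).
    rewrite -!plus_assoc; f_equal.
    rewrite !plus_assoc; f_equal; apply plus_comm.
Qed.

Lemma mcomb_scal l c f :
  mcomb l (fun i => c * f i)%C = scal (c : C_AbsRing) (mcomb l f).
Proof.
  revert f; induction l as [|v l IH]; intros f; simpl.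
  - now rewrite scal_zero_r.
  - rewrite (IH (fun i => f (S i))) scal_distr_l; f_equal.
    exact (eq_sym (scal_assoc (c : C_AbsRing) (f O) v)).
Qed.

Lemma mcomb_opp l f : mcomb l (fun i => - f i)%C = opp (mcomb l f).
Proof.
  rewrite -scal_opp_one.
  change (opp (one : C_AbsRing)) with (- RtoC 1)%C.
  rewrite -mcomb_scal; apply mcomb_ext; clear.
  generalize (length l) as n; intros n; revert f.
  induction n as [|n IH]; intros f; simpl; [exact I|].
  split; [ring|apply IH].
Qed.

Lemma mcomb_atom l n :
  mcomb l (fun i => if Nat.eqb n i then RtoC 1 else RtoC 0) = nth n l zero.
Proof.
  revert n; induction l as [|v l IH]; intros [|n]; try reflexivity; simpl.
  - rewrite mcomb_zero plus_zero_r; exact (scal_one v).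
  - rewrite IH; replace (scal (RtoC 0 : C_AbsRing) v) with (zero : V).
    + apply plus_zero_l.
    + exact (eq_sym (scal_zero_l (K := C_AbsRing) v)).
Qed.

Lemma mden_comb l e : mden l e = mcomb l (mcoef e).
Proof.
  induction e as [n| |a IHa b IHb|a IHa|c a IHa]; simpl.
  - symmetry; apply mcomb_atom.
  - symmetry; apply mcomb_zero.
  - rewrite IHa IHb -mcomb_plus; reflexivity.
  - rewrite IHa -mcomb_opp; reflexivity.
  - rewrite IHa -mcomb_scal; reflexivity.
Qed.

Lemma module_norm l a b :
  meq (length l) (mcoef a) (mcoef b) -> mden l a = mden l b.
Proof. rewrite !mden_comb; apply mcomb_ext. Qed.

End ModuleNormalization.

(* Atoms are compared up to conversion: the same vector may occur with
   different projections of the structure of its space.  The inner [match]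
   turns a failure of [unify] into the choice of the next branch. *)
Ltac in_list x l :=
  lazymatch l with
  | nil => constr:(false)
  | ?y :: ?l' =>
      match constr:(I) with
      | _ => let _ := match constr:(I) with _ => unify x y end in
             constr:(true)
      | _ => in_list x l'
      end
  end.

Ltac module_atoms V l t :=
  lazymatch t with
  | zero => l
  | plus ?a ?b => let l1 := module_atoms V l a in module_atoms V l1 b
  | minus ?a ?b => let l1 := module_atoms V l a in module_atoms V l1 b
  | opp ?a => module_atoms V l a
  | scal ?c ?a => module_atoms V l a
  | ?x => let b := in_list x l in
          lazymatch b with
          | true => l
          | false => constr:(@cons (CompleteNormedModule.sort C_AbsRing V) x l)
          end
  end.

Ltac module_index x l :=
  lazymatch l with
  | ?y :: ?l' =>
      match constr:(I) with
      | _ => let _ := match constr:(I) with _ => unify x y end in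
             constr:(O)
      | _ => let n := module_index x l' in constr:(S n)
      end
  end.

Ltac module_reify l t :=
  lazymatch t with
  | zero => constr:(MZero)
  | plus ?a ?b =>
      let ra := module_reify l a in let rb := module_reify l b in
      constr:(MPlus ra rb)
  | minus ?a ?b =>
      let ra := module_reify l a in let rb := module_reify l b in
      constr:(MPlus ra (MOpp rb))
  | opp ?a => let ra := module_reify l a in constr:(MOpp ra)
  | scal ?c ?a => let ra := module_reify l a in constr:(MScal c ra)
  | ?x => let n := module_index x l in constr:(MAtom n)
  end.

(** Reduces an identity between linear combinations of vectors of [V] to the
    identities between the complex coefficients of each vector. *)
Ltac module_eq V :=
  lazymatch goal with
  | |- ?a = ?b =>
      let l0 := constr:(@nil (CompleteNormedModule.sort C_AbsRing V)) in
      let l1 := module_atoms V l0 a in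
      let l := module_atoms V l1 b in
      let ra := module_reify l a in
      let rb := module_reify l b in
      apply (@module_norm V l ra rb); simpl; repeat split
  end.


(** * Norms and complex numbers *)

Lemma norm_scal_C (V : CompleteNormedModule C_AbsRing) (c : C) (v : V) :
  norm (scal (c : C_AbsRing) v) <= Cmod c * norm v.
Proof. exact (norm_scal (c : C_AbsRing) v). Qed.

Lemma norm_plus_le (V : CompleteNormedModule C_AbsRing) (u v : V) :
  norm (plus u v) <= norm u + norm v.
Proof. exact (norm_triangle u v). Qed.

Lemma norm_minus_le (V : CompleteNormedModule C_AbsRing) (u v : V) :
  norm (minus u v) <= norm u + norm v.
Proof. rewrite -(norm_opp v); exact (norm_triangle u (opp v)). Qed.

Lemma norm_eq_0 (V : CompleteNormedModule C_AbsRing) (v : V) :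
  norm v <= 0 -> v = zero.
Proof.
  intros H.
  exact (norm_eq_zero (K := C_AbsRing) v (Rle_antisym _ _ H (norm_ge_0 v))).
Qed.

Lemma minus_eq_0 (V : CompleteNormedModule C_AbsRing) (u v : V) :
  minus u v = zero -> u = v.
Proof.
  intros H; replace u with (plus (minus u v) v).
  - rewrite H; apply plus_zero_l.
  - module_eq V; ring.
Qed.

Lemma Cmod_sqr (z : C) : Cmod z ^ 2 = fst z ^ 2 + snd z ^ 2.
Proof. exact (Cmod2_alt z). Qed.

Lemma Cmod_pos_neq (z w : C) : 0 < Cmod (z - w) -> z <> w.
Proof.
  intros H Heq; rewrite Heq in H; revert H.
  replace (w - w)%C with (RtoC 0) by ring; rewrite Cmod_0; lra.
Qed.

Lemma Csub_neq_0 (z w : C) : z <> w -> (z - w)%C <> RtoC 0.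
Proof.
  intros Hz H; apply Hz; replace z with (z - w + w)%C by ring; rewrite H; ring.
Qed.

Lemma Cmod_sub_shift (z w h : C) : Cmod (z - w) <= Cmod (z - (w + h)) + Cmod h.
Proof.
  replace (z - w)%C with (z - (w + h) + h)%C by ring; apply Cmod_triangle.
Qed.

Lemma two_pi_i_neq_0 : (RtoC (2 * PI) * Ci)%C <> RtoC 0.
Proof.
  apply Cmult_neq_0; [|exact Ci_nz].
  intros H; apply RtoC_inj in H; generalize PI_RGT_0; lra.
Qed.

(** * Maxima of continuous functions on a rectangle *)

(** The side of the covering squares is chosen so as to control the local bounds
    too: [delta x y] is at most the inverse of the bound valid around [(x, y)],
    so that a positive lower bound of [delta] bounds [u]. *)
Lemma rectangle_bounded (u : R -> R -> R) (a b c d : R) :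
  (forall x y, a <= x <= b -> c <= y <= d ->
     exists M eta, 0 < eta /\
       forall x' y', a <= x' <= b -> c <= y' <= d ->
         Rabs (x' - x) < eta -> Rabs (y' - y) < eta -> u x' y' <= M) ->
  exists M, forall x y, a <= x <= b -> c <= y <= d -> u x y <= M.
Proof.
  intros Hloc.
  assert (Hch : forall x y, exists dl : posreal,
    a <= x <= b -> c <= y <= d ->
    forall x' y', a <= x' <= b -> c <= y' <= d ->
      Rabs (x' - x) < dl -> Rabs (y' - y) < dl -> u x' y' <= / dl).
  { intros x y.
    destruct (classic (a <= x <= b /\ c <= y <= d)) as [[Hx Hy]|Hn].
    - destruct (Hloc x y Hx Hy) as (M & eta & He & H).
      assert (HM : 0 < / (1 + Rabs M)).
      { apply Rinv_0_lt_compat; generalize (Rabs_pos M); lra. }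
      assert (Hd : 0 < Rmin eta (/ (1 + Rabs M))) by now apply Rmin_pos.
      exists (mkposreal _ Hd); intros _ _ x' y' Hx' Hy' Hdx Hdy; simpl in *.
      apply Rle_trans with M.
      + apply H; trivial; eapply Rlt_le_trans; eauto; apply Rmin_l.
      + apply Rle_trans with (1 + Rabs M).
        * generalize (Rle_abs M); lra.
        * rewrite -{1}(Rinv_inv (1 + Rabs M)).
          apply Rinv_le_contravar; [exact Hd|apply Rmin_r].
    - exists (mkposreal 1 Rlt_0_1); intros Hx Hy; tauto. }
  set (dl := fun x y => proj1_sig (constructive_indefinite_description _ (Hch x y))).
  assert (Hdl := fun x y => proj2_sig (constructive_indefinite_description _ (Hch x y))).
  change (forall x y, a <= x <= b -> c <= y <= d ->
    forall x' y', a <= x' <= b -> c <= y' <= d ->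
      Rabs (x' - x) < dl x y -> Rabs (y' - y) < dl x y ->
      u x' y' <= / dl x y) in Hdl.
  destruct (compactness_value_2d a b c d dl) as [m Hm].
  exists (/ m); intros x y Hx Hy.
  destruct (NNPP _ (Hm x y Hx Hy)) as (x0 & y0 & Hx0 & Hy0 & H1 & H2 & H3).
  apply Rle_trans with (/ dl x0 y0).
  - now apply Hdl.
  - apply Rinv_le_contravar; [apply cond_pos|exact H3].
Qed.

(** If the supremum [s] is not attained, then [1 / (s - u)] is locally bounded,
    hence bounded, and [s] is not the least upper bound. *)
Lemma rectangle_max (u : R -> R -> R) (a b c d : R) :
  a <= b -> c <= d ->
  (forall x y e, 0 < e -> exists eta, 0 < eta /\
     forall x' y', Rabs (x' - x) < eta -> Rabs (y' - y) < eta ->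
       Rabs (u x' y' - u x y) < e) ->
  exists x y, a <= x <= b /\ c <= y <= d /\
    forall x' y', a <= x' <= b -> c <= y' <= d -> u x' y' <= u x y.
Proof.
  intros Hab Hcd Hcont.
  destruct (@rectangle_bounded u a b c d) as [M HM].
  { intros x y Hx Hy; destruct (Hcont x y 1 Rlt_0_1) as (eta & He & H).
    exists (u x y + 1), eta; split; [exact He|].
    intros x' y' _ _ Hx' Hy'; generalize (H x' y' Hx' Hy').
    intros H'; apply Rabs_def2 in H'; lra. }
  pose (E := fun s => exists x y, a <= x <= b /\ c <= y <= d /\ s = u x y).
  destruct (completeness E) as [s [Hub Hlub]].
  { exists M; intros s (x & y & Hx & Hy & ->); now apply HM. }
  { exists (u a c), a, c; repeat split; lra. }
  apply NNPP; intros Hno.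
  assert (Hlt : forall x y, a <= x <= b -> c <= y <= d -> u x y < s).
  { intros x y Hx Hy; destruct (Rle_lt_or_eq_dec (u x y) s) as [H|H].
    - apply Hub; exists x, y; auto.
    - exact H.
    - exfalso; apply Hno; exists x, y; repeat split; try tauto.
      intros x' y' Hx' Hy'; rewrite H; apply Hub; exists x', y'; auto. }
  destruct (@rectangle_bounded (fun x y => / (s - u x y)) a b c d) as [N HN].
  { intros x y Hx Hy; assert (Hxy := Hlt x y Hx Hy).
    destruct (Hcont x y ((s - u x y) / 2)) as (eta & He & H); [lra|].
    exists (/ ((s - u x y) / 2)), eta; split; [exact He|].
    intros x' y' Hx' Hy' Hdx Hdy.
    apply Rinv_le_contravar; [lra|].
    specialize (H x' y' Hdx Hdy); apply Rabs_def2 in H; lra. }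
  assert (HN0 : 0 < N).
  { apply Rlt_le_trans with (/ (s - u a c)).
    - apply Rinv_0_lt_compat.
      assert (H := Hlt a c); lra.
    - apply HN; lra. }
  assert (Hs : s <= s - / N).
  { apply Hlub; intros r (x & y & Hx & Hy & ->).
    assert (H1 := HN x y Hx Hy); assert (H2 := Hlt x y Hx Hy).
    assert (H3 : / N <= s - u x y); [|lra].
    rewrite -(Rinv_inv (s - u x y)); apply Rinv_le_contravar; [|exact H1].
    apply Rinv_0_lt_compat; lra. }
  assert (H := Rinv_0_lt_compat N HN0); lra.
Qed.

(** * Liouville's theorem for functions with values in a Banach space *)

Section Liouville.

Variable V : CompleteNormedModule C_AbsRing.

(** This form of complex differentiability is just what the proof of Liouville's
    theorem exploits, and for resolvents and Cauchy integrals it follows from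
    algebraic identities. *)
Definition taylor2 (F : C -> V) (w : C) : Prop :=
  exists (a b : V) (K d : R), 0 < d /\
    forall h : C, Cmod h < d ->
      norm (minus (F (w + h)%C)
              (plus (F w) (plus (scal (h : C_AbsRing) a)
                                (scal ((h * h)%C : C_AbsRing) b))))
        <= K * Cmod h ^ 3.

Definition vanishes_at_infinity (F : C -> V) : Prop :=
  forall e, 0 < e -> exists r, forall w, r <= Cmod w -> norm (F w) <= e.

Lemma taylor2_ext_loc (F G : C -> V) (w : C) (e : R) :
  0 < e -> (forall h, Cmod h < e -> F (w + h)%C = G (w + h)%C) ->
  taylor2 G w -> taylor2 F w.
Proof.
  intros He Heq (a & b & K & d & Hd & H).
  assert (Hw : F w = G w).
  { replace w with (w + RtoC 0)%C by ring; apply Heq; now rewrite Cmod_0. }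
  exists a, b, K, (Rmin e d); split; [now apply Rmin_pos|].
  intros h Hh; rewrite Hw Heq.
  - apply H; eapply Rlt_le_trans; [exact Hh|apply Rmin_r].
  - eapply Rlt_le_trans; [exact Hh|apply Rmin_l].
Qed.

Lemma taylor2_lipschitz (F : C -> V) (w : C) :
  taylor2 F w ->
  exists L d, 0 <= L /\ 0 < d /\
    forall h, Cmod h < d -> norm (minus (F (w + h)%C) (F w)) <= L * Cmod h.
Proof.
  intros (a & b & K & d & Hd & H).
  exists (Rabs K + norm a + norm b), (Rmin d 1).
  assert (Ha := norm_ge_0 a); assert (Hb := norm_ge_0 b); assert (HK := Rabs_pos K).
  split; [lra|split; [apply Rmin_pos; lra|]].
  intros h Hh.
  assert (Hh1 : Cmod h < d) by (eapply Rlt_le_trans; [exact Hh|apply Rmin_l]).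
  assert (Hh2 : Cmod h < 1) by (eapply Rlt_le_trans; [exact Hh|apply Rmin_r]).
  assert (Hh0 := Cmod_ge_0 h); specialize (H h Hh1).
  replace (minus (F (w + h)%C) (F w)) with
    (plus (minus (F (w + h)%C)
             (plus (F w) (plus (scal (h : C_AbsRing) a)
                               (scal ((h * h)%C : C_AbsRing) b))))
          (plus (scal (h : C_AbsRing) a) (scal ((h * h)%C : C_AbsRing) b)))
    by (module_eq V; ring).
  assert (H1 := norm_scal_C h a); assert (H2 := norm_scal_C (h * h)%C b).
  rewrite Cmod_mult in H2.
  eapply Rle_trans; [apply norm_plus_le|].
  eapply Rle_trans; [apply Rplus_le_compat; [exact H|apply norm_plus_le]|].
  assert (H3 : K * Cmod h ^ 3 <= Rabs K * Cmod h).
  { apply Rle_trans with (Rabs K * Cmod h ^ 3).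
    - apply Rmult_le_compat_r; [apply pow_le; lra|apply Rle_abs].
    - apply Rmult_le_compat_l; [lra|]; simpl; nra. }
  assert (H4 : Cmod h * Cmod h * norm b <= Cmod h * norm b)
    by (apply Rmult_le_compat_r; [exact Hb|]; nra).
  lra.
Qed.

(** A weak mean value property: in the average of [F] over the four points
    [w + h], where [h] is [t], [- t], [i t] or [- i t], the terms in [h] and
    [h^2] of the expansion cancel. *)
Lemma taylor2_mean4 (F : C -> V) (w : C) :
  taylor2 F w ->
  exists K d, 0 < d /\ forall t, 0 < t < d ->
    4 * norm (F w) <=
      norm (F (w + RtoC t)%C) + norm (F (w - RtoC t)%C) +
      norm (F (w + Ci * RtoC t)%C) + norm (F (w - Ci * RtoC t)%C)
      + 4 * K * t ^ 3.
Proof.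
  intros (a & b & K & d & Hd & H); exists K, d; split; [exact Hd|].
  intros t Ht.
  set (rem := fun h => minus (F (w + h)%C)
              (plus (F w) (plus (scal (h : C_AbsRing) a)
                                (scal ((h * h)%C : C_AbsRing) b)))).
  assert (Hrem : forall h, Cmod h = t -> norm (rem h) <= K * t ^ 3).
  { intros h Hh; rewrite -Hh; apply H; rewrite Hh; lra. }
  assert (Hm : Cmod (RtoC t) = t) by (rewrite Cmod_R; apply Rabs_pos_eq; lra).
  assert (H1 := Hrem (RtoC t) Hm).
  assert (H2 := Hrem (- RtoC t)%C ltac:(now rewrite Cmod_opp)).
  assert (H3 := Hrem (Ci * RtoC t)%C ltac:(rewrite Cmod_mult Cmod_Ci Hm; ring)).
  assert (H4 := Hrem (- (Ci * RtoC t))%C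
                  ltac:(rewrite Cmod_opp Cmod_mult Cmod_Ci Hm; ring)).
  assert (Heq : scal (RtoC 4 : C_AbsRing) (F w) =
    minus (plus (plus (F (w + RtoC t)%C) (F (w - RtoC t)%C))
                (plus (F (w + Ci * RtoC t)%C) (F (w - Ci * RtoC t)%C)))
          (plus (plus (rem (RtoC t)) (rem (- RtoC t)%C))
                (plus (rem (Ci * RtoC t)%C) (rem (- (Ci * RtoC t))%C)))).
  { unfold rem, Cminus; module_eq V; try ring.
    replace (Ci * RtoC t * (Ci * RtoC t))%C with (- (RtoC t * RtoC t))%C.
    - replace (- (Ci * RtoC t) * - (Ci * RtoC t))%C
        with (- (RtoC t * RtoC t))%C; [ring|].
      replace (- (Ci * RtoC t) * - (Ci * RtoC t))%C
        with ((Ci * Ci) * (RtoC t * RtoC t))%C by ring.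
      replace (Ci * Ci)%C with (- RtoC 1)%C; [ring|].
      unfold Ci, Cmult, Copp, RtoC; simpl; f_equal; ring.
    - replace (Ci * RtoC t * (Ci * RtoC t))%C
        with ((Ci * Ci) * (RtoC t * RtoC t))%C by ring.
      replace (Ci * Ci)%C with (- RtoC 1)%C; [ring|].
      unfold Ci, Cmult, Copp, RtoC; simpl; f_equal; ring. }
  assert (H5 : 4 * norm (F w) <= norm (scal (RtoC 4 : C_AbsRing) (F w))).
  { replace (F w) with (scal (RtoC (/ 4) : C_AbsRing) (scal (RtoC 4 : C_AbsRing) (F w))) at 1.
    - assert (H5 := norm_scal_C (RtoC (/ 4)) (scal (RtoC 4 : C_AbsRing) (F w))).
      rewrite Cmod_R Rabs_pos_eq in H5; lra.
    - module_eq V; rewrite -!RtoC_mult; f_equal; field. }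
  rewrite Heq in H5.
  eapply Rle_trans; [exact H5|].
  eapply Rle_trans; [apply norm_minus_le|].
  eapply Rle_trans;
    [apply Rplus_le_compat; (eapply Rle_trans;
      [apply norm_plus_le|apply Rplus_le_compat; apply norm_plus_le])|].
  lra.
Qed.

(** If [F w0] has norm [m > 0], add to [norm F] the small strictly subharmonic
    function [del |w - w0|^2].  The sum is smaller far from [w0] than at [w0], so
    it has an interior maximum in a large square; there, the mean over four
    points at distance [t] exceeds the value by [del t^2] up to [O(t^3)], which
    contradicts maximality for small [t]. *)
Theorem liouville (F : C -> V) :
  (forall w, taylor2 F w) -> vanishes_at_infinity F -> forall w, F w = zero.
Proof.
  intros HT HF w0; apply norm_eq_0; apply Rnot_lt_le; intros Hm.
  set (m := norm (F w0)) in *.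
  destruct (HF (m / 2)) as [r Hr]; [lra|].
  set (rho := Rabs r + Cmod w0 + 1).
  assert (Hrho : 0 < rho)
    by (unfold rho; generalize (Rabs_pos r) (Cmod_ge_0 w0); lra).
  assert (Hfar : forall w, rho <= Cmod (w - w0) -> norm (F w) <= m / 2).
  { intros w Hw; apply Hr.
    assert (H := Cmod_triangle w (- w0)); rewrite Cmod_opp in H.
    generalize (Rle_abs r); unfold rho, Cminus in *; lra. }
  set (del := m / (8 * rho ^ 2)).
  assert (Hdel : 0 < del).
  { unfold del; apply Rdiv_lt_0_compat; [exact Hm|].
    apply Rmult_lt_0_compat; [lra|now apply pow_lt]. }
  assert (Hdelrho : del * rho ^ 2 = m / 8) by (unfold del; field; lra).
  destruct w0 as [x0 y0].
  set (u := fun x y => norm (F (x, y)) + del * ((x - x0) ^ 2 + (y - y0) ^ 2)).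
  destruct (@rectangle_max u (x0 - rho) (x0 + rho) (y0 - rho) (y0 + rho))
    as (x1 & y1 & Hx1 & Hy1 & Hmax); [lra|lra| |].
  { intros x y e He.
    destruct (taylor2_lipschitz (HT (x, y))) as (L & d & HL & Hd & Hlip).
    assert (Hc1 : continuous (fun z : R * R =>
      del * ((fst z - x0) ^ 2 + (snd z - y0) ^ 2)) (x, y)).
    { assert (Hsq : forall (f : R * R -> R) c, continuous f (x, y) ->
        continuous (fun z => (f z - c) ^ 2) (x, y)).
      { intros f c Hf; apply (continuous_comp f (fun a => (a - c) ^ 2)); [exact Hf|].
        apply (ex_derive_continuous (V := R_NormedModule)); auto_derive; exact I. }
      apply (continuous_mult (K := R_AbsRing) (fun _ => del));
        [apply continuous_const|].
      apply (continuous_plus (V := R_NormedModule)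
        (fun z : R * R => (fst z - x0) ^ 2) (fun z => (snd z - y0) ^ 2));
        apply Hsq; [apply continuous_fst|apply continuous_snd]. }
    assert (He2 : 0 < e / 2) by lra.
    destruct (proj1 (filterlim_locally _ _) Hc1 (mkposreal _ He2)) as [eta1 H1].
    set (eta := Rmin eta1 (Rmin (d / 2) (e / (4 * (L + 1))))).
    assert (Heta : 0 < eta).
    { repeat apply Rmin_pos; [apply cond_pos|lra|].
      apply Rdiv_lt_0_compat; lra. }
    exists eta; split; [exact Heta|]; intros x' y' Hx Hy.
    assert (B1 : Rabs (del * ((x' - x0) ^ 2 + (y' - y0) ^ 2) -
                       del * ((x - x0) ^ 2 + (y - y0) ^ 2)) < e / 2).
    { apply (H1 (x', y')); split; simpl;
        (eapply Rlt_le_trans; [eassumption|apply Rmin_l]). }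
    set (h := ((x' - x, y' - y) : C)).
    assert (Hh : Cmod h < Rmin d (e / (2 * (L + 1)))).
    { assert (Hh : Cmod h <= Rabs (x' - x) + Rabs (y' - y)).
      { replace h with (RtoC (x' - x) + Ci * RtoC (y' - y))%C.
        - eapply Rle_trans; [apply Cmod_triangle|].
          rewrite Cmod_mult Cmod_Ci !Cmod_R; lra.
        - unfold h, Ci, RtoC, Cmult, Cplus; simpl; f_equal; ring. }
      eapply Rle_lt_trans; [exact Hh|].
      assert (B2 : eta <= d / 2)
        by (unfold eta; eapply Rle_trans; [apply Rmin_r|apply Rmin_l]).
      assert (B3 : eta <= e / (4 * (L + 1)))
        by (unfold eta; eapply Rle_trans; [apply Rmin_r|apply Rmin_r]).
      replace (e / (4 * (L + 1))) with (e / (2 * (L + 1)) / 2) in B3 by (field; lra).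
      apply Rmin_glb_lt; lra. }
    assert (Hxy : (x', y') = ((x, y) + h)%C :> C).
    { unfold h, Cplus; simpl; f_equal; ring. }
    assert (B4 : Rabs (norm (F (x', y')) - norm (F (x, y))) <= L * Cmod h).
    { eapply Rle_trans; [apply (norm_triangle_inv (F (x', y')) (F (x, y)))|].
      rewrite Hxy; apply Hlip; eapply Rlt_le_trans; [exact Hh|apply Rmin_l]. }
    assert (B5 : L * Cmod h <= e / 2).
    { apply Rle_trans with ((L + 1) * (e / (2 * (L + 1)))).
      - apply Rmult_le_compat; [lra|apply Cmod_ge_0|lra|].
        apply Rlt_le; eapply Rlt_le_trans; [exact Hh|apply Rmin_r].
      - right; field; lra. }
    unfold u.
    match goal with |- Rabs ?t < _ =>
      replace t with ((norm (F (x', y')) - norm (F (x, y))) +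
       (del * ((x' - x0) ^ 2 + (y' - y0) ^ 2) -
        del * ((x - x0) ^ 2 + (y - y0) ^ 2))) by ring end.
    eapply Rle_lt_trans; [apply Rabs_triang|]; lra. }
  assert (Hu0 : m <= u x1 y1).
  { eapply Rle_trans; [|apply (Hmax x0 y0); lra].
    unfold u; fold m; apply Req_le; ring. }
  assert (Hint : (x1 - x0) ^ 2 < rho ^ 2 /\ (y1 - y0) ^ 2 < rho ^ 2).
  { assert (Hc : (x1 - x0) ^ 2 + (y1 - y0) ^ 2 < rho ^ 2).
    { apply Rnot_le_lt; intros Hc.
      assert (Hf : norm (F (x1, y1)) <= m / 2).
      { apply Hfar.
        apply Rsqr_incr_0_var; [|apply Cmod_ge_0].
        rewrite !Rsqr_pow2 Cmod_sqr; exact Hc. }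
      assert ((x1 - x0) ^ 2 <= rho ^ 2) by nra.
      assert ((y1 - y0) ^ 2 <= rho ^ 2) by nra.
      assert (del * ((x1 - x0) ^ 2 + (y1 - y0) ^ 2) <= 2 * (m / 8)).
      { rewrite -Hdelrho; nra. }
      unfold u in Hu0; lra. }
    generalize (pow2_ge_0 (x1 - x0)) (pow2_ge_0 (y1 - y0)); split; lra. }
  destruct Hint as [Hix Hiy].
  assert (Hjx : x0 - rho < x1 < x0 + rho) by (split; nra).
  assert (Hjy : y0 - rho < y1 < y0 + rho) by (split; nra).
  destruct (taylor2_mean4 (HT (x1, y1))) as (K & d & Hd & Hmean).
  set (t := Rmin (d / 2) (Rmin (Rmin (rho - (x1 - x0)) (rho + (x1 - x0)))
     (Rmin (Rmin (rho - (y1 - y0)) (rho + (y1 - y0))) (del / (2 * (Rabs K + 1)))))).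
  assert (HK := Rabs_pos K).
  assert (Ht : 0 < t).
  { unfold t; repeat apply Rmin_pos; try lra; apply Rdiv_lt_0_compat; lra. }
  assert (t1 : t <= d / 2) by apply Rmin_l.
  assert (t2 : t <= Rmin (Rmin (rho - (x1 - x0)) (rho + (x1 - x0)))
     (Rmin (Rmin (rho - (y1 - y0)) (rho + (y1 - y0))) (del / (2 * (Rabs K + 1)))))
    by apply Rmin_r.
  assert (t3 : t <= Rmin (rho - (x1 - x0)) (rho + (x1 - x0)))
    by (eapply Rle_trans; [exact t2|apply Rmin_l]).
  assert (t4 : t <= Rmin (Rmin (rho - (y1 - y0)) (rho + (y1 - y0))) (del / (2 * (Rabs K + 1))))
    by (eapply Rle_trans; [exact t2|apply Rmin_r]).
  assert (t5 : t <= Rmin (rho - (y1 - y0)) (rho + (y1 - y0)))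
    by (eapply Rle_trans; [exact t4|apply Rmin_l]).
  assert (t6 : t <= del / (2 * (Rabs K + 1)))
    by (eapply Rle_trans; [exact t4|apply Rmin_r]).
  assert (t31 := Rmin_l (rho - (x1 - x0)) (rho + (x1 - x0))).
  assert (t32 := Rmin_r (rho - (x1 - x0)) (rho + (x1 - x0))).
  assert (t51 := Rmin_l (rho - (y1 - y0)) (rho + (y1 - y0))).
  assert (t52 := Rmin_r (rho - (y1 - y0)) (rho + (y1 - y0))).
  clearbody t.
  specialize (Hmean t ltac:(lra)).
  replace ((x1, y1) + RtoC t)%C with ((x1 + t, y1) : C) in Hmean
    by (unfold Cplus, RtoC; simpl; f_equal; ring).
  replace ((x1, y1) - RtoC t)%C with ((x1 - t, y1) : C) in Hmean
    by (unfold Cminus, Cplus, Copp, RtoC; simpl; f_equal; ring).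
  replace ((x1, y1) + Ci * RtoC t)%C with ((x1, y1 + t) : C) in Hmean
    by (unfold Cplus, Cmult, Ci, RtoC; simpl; f_equal; ring).
  replace ((x1, y1) - Ci * RtoC t)%C with ((x1, y1 - t) : C) in Hmean
    by (unfold Cminus, Cplus, Copp, Cmult, Ci, RtoC; simpl; f_equal; ring).
  assert (M1 := Hmax (x1 + t) y1 ltac:(lra) ltac:(lra)).
  assert (M2 := Hmax (x1 - t) y1 ltac:(lra) ltac:(lra)).
  assert (M3 := Hmax x1 (y1 + t) ltac:(lra) ltac:(lra)).
  assert (M4 := Hmax x1 (y1 - t) ltac:(lra) ltac:(lra)).
  unfold u in M1, M2, M3, M4.
  assert (Hfin : 4 * del * t ^ 2 <= 4 * K * t ^ 3) by nra.
  assert (Hfin2 : del <= Rabs K * t).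
  { assert (4 * K * t ^ 3 <= 4 * Rabs K * t ^ 3).
    { assert (0 < t ^ 3) by now apply pow_lt.
      generalize (Rle_abs K); nra. }
    apply Rmult_le_reg_r with (4 * t ^ 2); [|nra].
    assert (0 < t ^ 2) by now apply pow_lt. lra. }
  assert (Rabs K * t <= del / 2); [|lra].
  apply Rle_trans with ((Rabs K + 1) * (del / (2 * (Rabs K + 1)))).
  - apply Rmult_le_compat; lra.
  - right; field; lra.
Qed.

End Liouville.

(** * Continuity *)

Section Continuity.

Variable V : CompleteNormedModule C_AbsRing.

Lemma continuous_norm (f : R -> V) (t : R) :
  continuous f t <->
  (forall e, 0 < e -> exists d, 0 < d /\
     forall s, Rabs (s - t) < d -> norm (minus (f s) (f t)) < e).
Proof.
  split.
  - intros H e He.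
    assert (H1 : locally t (fun s => norm (minus (f s) (f t)) < e)).
    { apply (H (fun v : V => norm (minus v (f t)) < e)).
      apply (locally_le_locally_norm (K := C_AbsRing) (V := V) (f t)).
      exists (mkposreal e He); intros y Hy; exact Hy. }
    destruct H1 as [d Hd]; exists d; split; [apply cond_pos|].
    intros s Hs; apply Hd; exact Hs.
  - intros H; apply filterlim_locally; intros e.
    destruct (H e (cond_pos e)) as (d & Hd & H1).
    exists (mkposreal d Hd); intros s Hs.
    exact (norm_compat1 (K := C_AbsRing) (V := V) _ _ _ (H1 s Hs)).
Qed.

Lemma continuous_bounded (f : R -> V) :
  (forall t, 0 <= t <= 1 -> continuous f t) ->
  exists M, 0 <= M /\ forall t, 0 <= t <= 1 -> norm (f t) <= M.
Proof.
  intros H.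
  destruct (@continuity_ab_maj (fun t => norm (f t)) 0 1) as (t0 & Hmax & Ht0).
  - lra.
  - intros t Ht; apply continuity_pt_filterlim.
    apply (@continuous_comp _ _ _ f (fun v : V => norm v)); [now apply H|].
    exact (filterlim_norm (K := C_AbsRing) (V := V) (f t)).
  - exists (norm (f t0)); split; [apply norm_ge_0|exact Hmax].
Qed.

End Continuity.

Lemma continuous_C_AbsRing (T : UniformSpace) (f : T -> C) (x : T) :
  @continuous T C_UniformSpace f x ->
  @continuous T (AbsRing_UniformSpace C_AbsRing) f x.
Proof. intros H P HP; apply H; now apply locally_C. Qed.

Lemma continuous_Cplus (T : UniformSpace) (f g : T -> C) (x : T) :
  @continuous T C_UniformSpace f x -> @continuous T C_UniformSpace g x ->
  @continuous T C_UniformSpace (fun y => f y + g y)%C x.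
Proof. exact (@continuous_plus T C_AbsRing C_NormedModule f g x). Qed.

Lemma continuous_Cmult (T : UniformSpace) (f g : T -> C) (x : T) :
  @continuous T C_UniformSpace f x -> @continuous T C_UniformSpace g x ->
  @continuous T C_UniformSpace (fun y => f y * g y)%C x.
Proof.
  intros Hf Hg; apply (@continuous_scal T C_AbsRing C_NormedModule f g x);
    [now apply continuous_C_AbsRing|exact Hg].
Qed.

Lemma Cinv_expand (z h : C) :
  z <> RtoC 0 -> (z + h)%C <> RtoC 0 ->
  (/ (z + h) = / z + (h * (- (/ z * / z))
     + (h * h * (/ z * / z * / z) - h * h * h * (/ z * / z * / z * / (z + h)))))%C.
Proof. intros; field; auto. Qed.

Lemma Cinv_taylor2 (z : C) :
  z <> RtoC 0 -> taylor2 (V := C_CompleteNormedModule) Cinv z.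
Proof.
  intros Hz; assert (Hm := proj1 (Cmod_gt_0 z) Hz).
  exists (- (/ z * / z))%C, (/ z * / z * / z)%C,
    (/ Cmod z * / Cmod z * / Cmod z * (2 / Cmod z)), (Cmod z / 2).
  split; [lra|]; intros h Hh.
  assert (Hzh : Cmod z / 2 <= Cmod (z + h)).
  { assert (H := Cmod_triangle (z + h) (- h)); rewrite Cmod_opp in H.
    replace (z + h + - h)%C with z in H by ring; lra. }
  assert (Hzh0 : (z + h)%C <> RtoC 0) by (apply Cmod_gt_0; lra).
  change (Cmod ( / (z + h) - (/ z + (h * (- (/ z * / z)) + (h * h) * (/ z * / z * / z))))
    <= / Cmod z * / Cmod z * / Cmod z * (2 / Cmod z) * Cmod h ^ 3).
  rewrite (Cinv_expand Hz Hzh0).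
  match goal with |- Cmod ?t <= _ => replace t with
    (- (h * h * h * (/ z * / z * / z * / (z + h))))%C by ring end.
  rewrite Cmod_opp !Cmod_mult !Cmod_inv; auto.
  assert (H : / Cmod (z + h) <= 2 / Cmod z).
  { replace (2 / Cmod z) with (/ (Cmod z / 2)) by (field; lra).
    apply Rinv_le_contravar; lra. }
  assert (Hi := Rinv_0_lt_compat _ Hm).
  assert (Hh0 := Cmod_ge_0 h).
  replace (Cmod h * Cmod h * Cmod h *
    (/ Cmod z * / Cmod z * / Cmod z * / Cmod (z + h)))
    with (/ Cmod z * / Cmod z * / Cmod z * / Cmod (z + h) * Cmod h ^ 3) by ring.
  apply Rmult_le_compat_r; [now apply pow_le|].
  apply Rmult_le_compat_l; [|exact H].
  apply Rlt_le; repeat apply Rmult_lt_0_compat; exact Hi.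
Qed.

Lemma taylor2_continuous (V : CompleteNormedModule C_AbsRing)
    (F : C -> V) (w : C) :
  taylor2 F w -> @continuous C_UniformSpace V F w.
Proof.
  intros HF; destruct (taylor2_lipschitz HF) as (K & d & HK & Hd & H).
  apply filterlim_locally; intros e.
  assert (He' : 0 < Rmin d (e / (K + 1))).
  { apply Rmin_pos; [exact Hd|apply Rdiv_lt_0_compat; [apply cond_pos|lra]]. }
  apply (locally_le_locally_norm (K := C_AbsRing) (V := C_NormedModule)).
  exists (mkposreal _ He'); intros y Hy.
  change (Cmod (y - w) < Rmin d (e / (K + 1))) in Hy.
  apply (norm_compat1 (K := C_AbsRing) (V := V)).
  replace y with (w + (y - w))%C by ring.
  eapply Rle_lt_trans; [apply H; eapply Rlt_le_trans; [exact Hy|apply Rmin_l]|].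
  assert (H2 : Cmod (y - w) < e / (K + 1))
    by (eapply Rlt_le_trans; [exact Hy|apply Rmin_r]).
  apply Rle_lt_trans with ((K + 1) * Cmod (y - w)).
  - generalize (Cmod_ge_0 (y - w)); nra.
  - apply Rmult_lt_reg_r with (/ (K + 1)); [apply Rinv_0_lt_compat; lra|].
    replace ((K + 1) * Cmod (y - w) * / (K + 1)) with (Cmod (y - w))
      by (field; lra); exact H2.
Qed.

Lemma continuous_Cinv (T : UniformSpace) (g : T -> C) (t : T) :
  g t <> RtoC 0 -> @continuous T C_UniformSpace g t ->
  @continuous T C_UniformSpace (fun s => / g s)%C t.
Proof.
  intros H0 Hg; apply (continuous_comp g Cinv); [exact Hg|].
  exact (taylor2_continuous (V := C_CompleteNormedModule) (Cinv_taylor2 H0)).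
Qed.

(** * Integrals along arcs *)

Lemma is_RInt_linear (X Y : CompleteNormedModule C_AbsRing) (l : X -> Y)
    (f : R -> X) (a b : R) (If : X) :
  is_linear l ->
  is_RInt (V := realify X) f a b If ->
  is_RInt (V := realify Y) (fun t => l (f t)) a b (l If).
Proof.
  intros Hl Hf.
  assert (Hl' : is_linear (U := realify X) (V := realify Y) l).
  { split; [exact (linear_plus l Hl)| |exact (linear_norm l Hl)].
    intros k x; exact (linear_scal l Hl (RtoC k) x). }
  assert (Hsum : forall ptd,
    Riemann_sum (V := realify Y) (fun t => l (f t)) ptd =
    l (Riemann_sum (V := realify X) f ptd)).
  { intros ptd; apply (SF_cons_ind (T := R) (fun ptd =>
      Riemann_sum (V := realify Y) (fun t => l (f t)) ptd =
      l (Riemann_sum (V := realify X) f ptd))).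
    - intros x0; exact (eq_sym (linear_zero (U := realify X) (V := realify Y) l Hl')).
    - intros h s IH; rewrite !Riemann_sum_cons IH.
      rewrite (linear_plus (U := realify X) (V := realify Y) l Hl').
      now rewrite (linear_scal (U := realify X) (V := realify Y) l Hl'). }
  unfold is_RInt.
  eapply filterlim_ext; [|eapply filterlim_comp;
    [exact Hf|exact (linear_cont (U := realify X) (V := realify Y) l If Hl')]].
  intros ptd; simpl.
  rewrite (linear_scal (U := realify X) (V := realify Y) l Hl').
  now rewrite Hsum.
Qed.

(** Reparametrization by [clamp] makes continuity on [0,1] a statement about
    continuity on the whole line, as required by the criterion of
    integrability. *)
Definition clamp (t : R) : R := Rmax 0 (Rmin 1 t).

Lemma clamp_range t : 0 <= clamp t <= 1.
Proof.
  unfold clamp; split; [apply Rmax_l|].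
  apply Rmax_lub; [lra|apply Rmin_l].
Qed.

Lemma clamp_id t : 0 <= t <= 1 -> clamp t = t.
Proof.
  intros H; unfold clamp; rewrite Rmin_right; [|lra]; rewrite Rmax_right; lra.
Qed.

Lemma clamp_lipschitz s t : Rabs (clamp s - clamp t) <= Rabs (s - t).
Proof.
  unfold clamp, Rmax, Rmin.
  repeat destruct Rle_dec; unfold Rabs; repeat destruct Rcase_abs; lra.
Qed.

Lemma continuous_clamp (U : UniformSpace) (f : R -> U) (t : R) :
  continuous f (clamp t) -> continuous (fun s => f (clamp s)) t.
Proof.
  intros H; apply (continuous_comp clamp f); [|exact H].
  apply filterlim_locally; intros e; exists e; intros s Hs.
  eapply Rle_lt_trans; [apply clamp_lipschitz|exact Hs].
Qed.

Definition on_arcs (L : list (R -> C)) (z : C) : Prop :=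
  exists g t, In g L /\ 0 <= t <= 1 /\ z = g t.

Section ArcIntegrals.

Variable V : CompleteNormedModule C_AbsRing.

(** Parameters are clamped so that nothing is asked of [f] beyond the end points
    of an arc.  This matters for functions such as
    [fun z => scal (/ (z - w)) (phi z)] with [phi] vanishing on the arcs near
    [w]: an arc extended beyond its end points may well run through [w]. *)
Definition continuous_along (L : list (R -> C)) (f : C -> V) : Prop :=
  forall g t, In g L -> continuous (fun s => f (g (clamp s))) t.

Definition arcs_integral (L : list (R -> C)) (f : C -> V) : V :=
  fold_right (fun g s => plus (arc_integral g f) s) zero L.

Lemma arc_integral_correct (g : R -> C) (f : C -> V) :
  C1_arc g -> continuous_along (g :: nil) f ->
  is_RInt (V := realify V)
    (fun t => scal (velocity g t : C_AbsRing) (f (g t))) 0 1 (arc_integral g f).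
Proof.
  intros Hg Hf; unfold arc_integral.
  apply (RInt_correct (V := realify V)).
  apply (ex_RInt_ext (V := realify V) (fun t =>
    scal (velocity g (clamp t) : C_AbsRing) (f (g (clamp t))) : V)).
  - intros t Ht; rewrite Rmin_left in Ht; [|lra].
    rewrite Rmax_right in Ht; [|lra]; now rewrite clamp_id; [|lra].
  - apply (ex_RInt_continuous (V := realify V)); intros t _.
    apply (continuous_scal (K := C_AbsRing) (V := V)
      (fun t => velocity g (clamp t)) (fun t => f (g (clamp t)))).
    + apply continuous_C_AbsRing.
      apply (continuous_clamp (U := C_UniformSpace)).
      apply Hg, clamp_range.
    + apply Hf; now left.
Qed.

Lemma continuous_along_cons (g : R -> C) (L : list (R -> C)) (f : C -> V) :
  continuous_along (g :: L) f <->
  continuous_along (g :: nil) f /\ continuous_along L f.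
Proof.
  split.
  - intros H; split; intros g' t Hin; apply H; [destruct Hin as [->|[]]; now left|now right].
  - intros [H1 H2] g' t [->|Hin]; [apply H1; now left|now apply H2].
Qed.

Lemma continuous_along_plus (L : list (R -> C)) (f f' : C -> V) :
  continuous_along L f -> continuous_along L f' ->
  continuous_along L (fun z => plus (f z) (f' z)).
Proof.
  intros H H' g t Hin; apply (continuous_plus (K := C_AbsRing) (V := V));
    [now apply H|now apply H'].
Qed.

Lemma continuous_along_bounded (L : list (R -> C)) (f : C -> V) :
  continuous_along L f ->
  exists M, 0 <= M /\ forall z, on_arcs L z -> norm (f z) <= M.
Proof.
  induction L as [|g L IH]; intros Hf.
  - exists 0; split; [lra|]; intros z (g & t & [] & _).
  - destruct (proj1 (continuous_along_cons g L f) Hf) as [H1 H2].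
    destruct (IH H2) as (M & HM & HL).
    destruct (continuous_bounded (V := V) (f := fun s => f (g (clamp s)))) as (N & HN & Hg).
    { intros t _; apply H1; now left. }
    exists (Rmax M N); split; [eapply Rle_trans; [exact HM|apply Rmax_l]|].
    intros z (g' & t & [Heq|Hin] & Ht & ->).
    + subst g'; eapply Rle_trans; [|apply Rmax_r].
      rewrite -(clamp_id Ht); now apply Hg.
    + eapply Rle_trans; [apply HL; exists g', t; auto|apply Rmax_l].
Qed.

Lemma arcs_integral_ext (L : list (R -> C)) (f f' : C -> V) :
  (forall z, on_arcs L z -> f z = f' z) ->
  arcs_integral L f = arcs_integral L f'.
Proof.
  induction L as [|g L IH]; intros Heq; [reflexivity|]; simpl.
  rewrite IH.
  - f_equal; apply (RInt_ext (V := realify V)); intros t Ht.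
    rewrite Rmin_left in Ht; [|lra]; rewrite Rmax_right in Ht; [|lra].
    f_equal; apply Heq; exists g, t; split; [now left|split; [lra|reflexivity]].
  - intros z (g' & t & Hin & Ht & ->); apply Heq; exists g', t; split; [now right|auto].
Qed.

Lemma arcs_integral_plus (L : list (R -> C)) (f f' : C -> V) :
  List.Forall C1_arc L -> continuous_along L f -> continuous_along L f' ->
  arcs_integral L (fun z => plus (f z) (f' z)) =
  plus (arcs_integral L f) (arcs_integral L f').
Proof.
  induction L as [|g L IH]; intros HL Hf Hf'; simpl.
  - now rewrite plus_zero_l.
  - inversion_clear HL as [|? ? Hg HL'].
    apply continuous_along_cons in Hf; apply continuous_along_cons in Hf'.
    rewrite (IH HL' (proj2 Hf) (proj2 Hf')).
    replace (arc_integral g (fun z => plus (f z) (f' z)))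
      with (plus (arc_integral g f) (arc_integral g f')).
    + module_eq V; ring.
    + symmetry; apply (is_RInt_unique (V := realify V)).
      apply (is_RInt_ext (V := realify V) (fun t =>
        plus (scal (velocity g t : C_AbsRing) (f (g t)))
             (scal (velocity g t : C_AbsRing) (f' (g t))))).
      * intros t _; symmetry.
        exact (scal_distr_l (velocity g t : C_AbsRing) (f (g t)) (f' (g t))).
      * apply (is_RInt_plus (V := realify V));
          apply arc_integral_correct; tauto.
Qed.

End ArcIntegrals.

Lemma continuous_along_linear (X Y : CompleteNormedModule C_AbsRing)
    (l : X -> Y) (L : list (R -> C)) (f : C -> X) :
  is_linear l -> continuous_along L f -> continuous_along L (fun z => l (f z)).
Proof.
  intros Hl Hf g t Hin.
  apply (continuous_comp (fun s => f (g (clamp s))) l); [now apply Hf|].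
  exact (linear_cont l _ Hl).
Qed.

Lemma arcs_integral_linear (X Y : CompleteNormedModule C_AbsRing)
    (l : X -> Y) (L : list (R -> C)) (f : C -> X) :
  is_linear l -> List.Forall C1_arc L -> continuous_along L f ->
  arcs_integral L (fun z => l (f z)) = l (arcs_integral L f).
Proof.
  intros Hl; induction L as [|g L IH]; intros HL Hf; simpl.
  - symmetry; exact (linear_zero l Hl).
  - inversion_clear HL as [|? ? Hg HL'].
    apply continuous_along_cons in Hf.
    rewrite (IH HL' (proj2 Hf)) (linear_plus l Hl); f_equal.
    apply (is_RInt_unique (V := realify Y)).
    apply (is_RInt_ext (V := realify Y) (fun t =>
      l (scal (velocity g t : C_AbsRing) (f (g t))))).
    + intros t _; apply (linear_scal l Hl).
    + apply is_RInt_linear; [exact Hl|apply arc_integral_correct; tauto].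
Qed.

Lemma is_linear_scal (V : CompleteNormedModule C_AbsRing) (c : C) :
  is_linear (fun v : V => scal (c : C_AbsRing) v).
Proof. exact (is_linear_scal_r (K := C_AbsRing) (V := V) c Cmult_comm). Qed.

Lemma arcs_integral_scal (V : CompleteNormedModule C_AbsRing)
    (L : list (R -> C)) (c : C) (f : C -> V) :
  List.Forall C1_arc L -> continuous_along L f ->
  arcs_integral L (fun z => scal (c : C_AbsRing) (f z)) =
  scal (c : C_AbsRing) (arcs_integral L f).
Proof. exact (arcs_integral_linear (is_linear_scal V c)). Qed.

(** The bound [B] is a bound of the lengths of the arcs; it does not depend on
    the space of values. *)
Lemma arcs_integral_bound (L : list (R -> C)) :
  List.Forall C1_arc L ->
  exists B, 0 <= B /\
    forall (V : CompleteNormedModule C_AbsRing) (f : C -> V) (M : R),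
      0 <= M -> continuous_along L f ->
      (forall z, on_arcs L z -> norm (f z) <= M) ->
      norm (arcs_integral L f) <= B * M.
Proof.
  induction L as [|g L IH]; intros HL.
  - exists 0; split; [lra|]; intros V f M HM _ _; simpl.
    rewrite (norm_zero (K := C_AbsRing) (V := V)); lra.
  - inversion_clear HL as [|? ? Hg HL'].
    destruct (IH HL') as (B & HB & H).
    destruct (continuous_bounded (V := C_CompleteNormedModule) (f := velocity g))
      as (N & HN & Hv); [intros t Ht; now apply Hg|].
    exists (N + B); split; [lra|]; intros V f M HM Hf Hb; simpl.
    apply continuous_along_cons in Hf; destruct Hf as [Hf1 Hf2].
    eapply Rle_trans; [apply norm_plus_le|].
    rewrite Rmult_plus_distr_r; apply Rplus_le_compat.
    + replace (N * M) with ((1 - 0) * (N * M)) by ring.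
      apply (norm_RInt_le_const (V := realify V)
        (fun t => scal (velocity g t : C_AbsRing) (f (g t)) : V) 0 1);
        [lra| |now apply arc_integral_correct].
      intros t Ht; eapply Rle_trans; [apply (norm_scal_C (V := V))|].
      apply Rmult_le_compat; [apply Cmod_ge_0|apply norm_ge_0|now apply Hv|].
      apply Hb; exists g, t; split; [now left|auto].
    + apply H; trivial; intros z (g' & t & Hin & Ht & ->).
      apply Hb; exists g', t; split; [now right|auto].
Qed.

(** * Cauchy integrals *)

Lemma C1_arc_continuous (g : R -> C) (t : R) :
  C1_arc g -> @continuous _ C_UniformSpace (fun s => g (clamp s)) t.
Proof.
  intros Hg; apply (continuous_clamp (U := C_UniformSpace)).
  destruct (Hg (clamp t) (clamp_range t)) as [H _].
  exact (ex_derive_continuous _ _ H).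
Qed.

Lemma arcs_bounded (L : list (R -> C)) :
  List.Forall C1_arc L ->
  exists M, 0 <= M /\ forall z, on_arcs L z -> Cmod z <= M.
Proof.
  intros HL.
  apply (continuous_along_bounded (V := C_CompleteNormedModule) (f := fun z => z)).
  intros g t Hin; apply C1_arc_continuous.
  exact (proj1 (List.Forall_forall _ _) HL g Hin).
Qed.

Section CauchyIntegral.

Variable V : CompleteNormedModule C_AbsRing.
Variable L : list (R -> C).
Hypothesis HL : List.Forall C1_arc L.

(** On the arcs, [phi] vanishes at distance less than [d] from [w].  The arcs
    themselves may pass through [w]; this is the case for the indicator
    function of one piece of the domain and a point [w] of another piece. *)
Definition supported_off (phi : C -> V) (w : C) (d : R) : Prop :=
  forall z, on_arcs L z -> phi z = zero \/ d <= Cmod (z - w).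

Definition cauchy_integral (phi : C -> V) (w : C) : V :=
  arcs_integral L (fun z => scal (/ (z - w) : C_AbsRing)%C (phi z)).

Lemma continuous_along_kernel (k : C -> C) (phi : C -> V) (w : C) (d : R) :
  continuous_along L phi -> supported_off phi w d ->
  (forall z, d <= Cmod (z - w) -> @continuous C_UniformSpace C_UniformSpace k z) ->
  continuous_along L (fun z => scal (k z : C_AbsRing) (phi z)).
Proof.
  intros Hphi Hs Hk g t Hin.
  assert (Hg := proj1 (List.Forall_forall _ _) HL g Hin).
  assert (Hgc := C1_arc_continuous (t := t) Hg).
  destruct (Rle_lt_dec d (Cmod (g (clamp t) - w))) as [Hd|Hd].
  - apply (continuous_scal (K := C_AbsRing) (V := V)
      (fun s => k (g (clamp s))) (fun s => phi (g (clamp s)))).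
    + apply continuous_C_AbsRing.
      apply (continuous_comp (fun s => g (clamp s)) k); [exact Hgc|now apply Hk].
    + now apply Hphi.
  - apply continuous_norm; intros e He.
    destruct (proj1 (continuous_norm (V := C_CompleteNormedModule) _ _) Hgc
                (d - Cmod (g (clamp t) - w))) as (del & Hdel & H); [lra|].
    exists del; split; [exact Hdel|]; intros s Hst.
    assert (H0 : forall s, Rabs (s - t) < del -> phi (g (clamp s)) = zero).
    { intros s' Hs'; destruct (Hs (g (clamp s'))) as [H1|H1].
      - exists g, (clamp s'); auto using clamp_range.
      - exact H1.
      - exfalso; specialize (H s' Hs').
        change (Cmod (g (clamp s') - g (clamp t)) < d - Cmod (g (clamp t) - w)) in H.
        assert (H2 := Cmod_triangle (g (clamp s') - g (clamp t)) (g (clamp t) - w)).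
        replace (g (clamp s') - g (clamp t) + (g (clamp t) - w))%C
          with (g (clamp s') - w)%C in H2 by ring; lra. }
    rewrite (H0 s Hst) (H0 t); [|now rewrite Rminus_diag Rabs_R0].
    match goal with |- norm ?x < e => replace x with (zero : V) end.
    + rewrite (norm_zero (K := C_AbsRing) (V := V)); exact He.
    + module_eq V.
Qed.

Lemma continuous_sub (w z : C) :
  @continuous C_UniformSpace C_UniformSpace (fun z => z - w)%C z.
Proof.
  apply (continuous_Cplus (f := fun z => z) (g := fun _ => (- w)%C));
    [apply continuous_id|apply continuous_const].
Qed.

Lemma continuous_inv_sub (w z : C) :
  z <> w -> @continuous C_UniformSpace C_UniformSpace (fun z => / (z - w))%C z.
Proof.
  intros Hz; apply (continuous_Cinv (g := fun z => (z - w)%C)).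
  - now apply Csub_neq_0.
  - apply continuous_sub.
Qed.

Lemma continuous_along_cauchy (phi : C -> V) (w : C) (d : R) :
  0 < d -> continuous_along L phi -> supported_off phi w d ->
  continuous_along L (fun z => scal (/ (z - w) : C_AbsRing)%C (phi z)).
Proof.
  intros Hd Hphi Hs.
  apply (continuous_along_kernel (k := fun z => (/ (z - w))%C) Hphi Hs).
  intros z Hz; apply continuous_inv_sub, Cmod_pos_neq; lra.
Qed.

(** Integrate the second-order expansion of [1 / (z - w - h)] in [h].  The first
    coefficient is made explicit for the sake of [index_locally_constant]. *)
Lemma cauchy_expansion (phi : C -> V) (w : C) (d : R) :
  0 < d -> continuous_along L phi -> supported_off phi w d ->
  exists (b : V) (K : R), 0 <= K /\ forall h, Cmod h < d / 2 ->
    norm (minus (cauchy_integral phi (w + h)%C)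
      (plus (cauchy_integral phi w)
        (plus (scal (h : C_AbsRing)
                 (arcs_integral L (fun z =>
                    scal (/ (z - w) * / (z - w) : C_AbsRing)%C (phi z))))
              (scal ((h * h)%C : C_AbsRing) b))))
      <= K * Cmod h ^ 3.
Proof.
  intros Hd Hphi Hs.
  destruct (continuous_along_bounded Hphi) as (M & HM & HMb).
  destruct (arcs_integral_bound HL) as (B & HB & HBb).
  exists (arcs_integral L (fun z =>
    scal (/ (z - w) * / (z - w) * / (z - w) : C_AbsRing)%C (phi z))).
  exists (B * (/ d * / d * / d * (2 / d) * M)).
  assert (Hi := Rinv_0_lt_compat _ Hd).
  assert (Hi2 : 0 < 2 / d) by (unfold Rdiv; lra).
  split.
  { repeat (apply Rmult_le_pos; try lra). }
  intros h Hh.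
  set (rem := fun z => scal (h * h * h * (/ (z - w) * / (z - w) * / (z - w) *
     / (z - (w + h))) : C_AbsRing)%C (phi z)).
  assert (Hzw : forall z, d <= Cmod (z - w) -> z <> w).
  { intros z Hz; apply Cmod_pos_neq; lra. }
  assert (Hzh : forall z, d <= Cmod (z - w) -> d / 2 <= Cmod (z - (w + h))).
  { intros z Hz; assert (H := Cmod_sub_shift z w h); lra. }
  assert (Hzh' : forall z, d <= Cmod (z - w) -> z <> (w + h)%C).
  { intros z Hz; apply Cmod_pos_neq; specialize (Hzh z Hz); lra. }
  assert (C1 := continuous_along_cauchy Hd Hphi Hs).
  assert (C2 : continuous_along L (fun z =>
     scal (/ (z - w) * / (z - w) : C_AbsRing)%C (phi z))).
  { apply (continuous_along_kernel (k := fun z => (/ (z - w) * / (z - w))%C) Hphi Hs).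
    intros z Hz; apply continuous_Cmult; apply continuous_inv_sub; auto. }
  assert (C3 : continuous_along L (fun z =>
     scal (/ (z - w) * / (z - w) * / (z - w) : C_AbsRing)%C (phi z))).
  { apply (continuous_along_kernel
      (k := fun z => (/ (z - w) * / (z - w) * / (z - w))%C) Hphi Hs).
    intros z Hz; apply continuous_Cmult; [apply continuous_Cmult|];
      apply continuous_inv_sub; auto. }
  assert (C4 : continuous_along L rem).
  { apply (continuous_along_kernel (k := fun z =>
       (h * h * h * (/ (z - w) * / (z - w) * / (z - w) * / (z - (w + h))))%C) Hphi Hs).
    intros z Hz; apply continuous_Cmult; [apply continuous_const|].
    apply continuous_Cmult; [apply continuous_Cmult; [apply continuous_Cmult|]|];
      apply continuous_inv_sub; auto. }
  assert (Heq : cauchy_integral phi (w + h)%C =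
    plus (cauchy_integral phi w)
      (plus (scal (h : C_AbsRing) (arcs_integral L (fun z =>
               scal (/ (z - w) * / (z - w) : C_AbsRing)%C (phi z))))
        (plus (scal ((h * h)%C : C_AbsRing) (arcs_integral L (fun z =>
             scal (/ (z - w) * / (z - w) * / (z - w) : C_AbsRing)%C (phi z))))
           (arcs_integral L rem)))).
  { unfold cauchy_integral.
    rewrite -(arcs_integral_scal h HL C2) -(arcs_integral_scal (h * h)%C HL C3).
    assert (C2' := continuous_along_linear (is_linear_scal V h) C2).
    assert (C3' := continuous_along_linear (is_linear_scal V (h * h)%C) C3).
    simpl in C2', C3'.
    rewrite -(arcs_integral_plus HL C3' C4).
    rewrite -(arcs_integral_plus HL C2' (continuous_along_plus C3' C4)).
    rewrite -(arcs_integral_plus HL C1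
      (continuous_along_plus C2' (continuous_along_plus C3' C4))).
    apply arcs_integral_ext; intros z Hz; unfold rem.
    destruct (Hs z Hz) as [H0|H0].
    - rewrite H0; module_eq V.
    - module_eq V.
      field; split; apply Csub_neq_0; auto. }
  rewrite Heq.
  match goal with |- norm ?x <= _ => replace x with (arcs_integral L rem) end.
  2: module_eq V; ring.
  replace (B * (/ d * / d * / d * (2 / d) * M) * Cmod h ^ 3)
    with (B * (Cmod h ^ 3 * (/ d * / d * / d * (2 / d)) * M)) by ring.
  assert (Hh3 : 0 <= Cmod h ^ 3) by apply pow_le, Cmod_ge_0.
  assert (Hc0 : 0 <= / d * / d * / d * (2 / d)) by (repeat (apply Rmult_le_pos; try lra)).
  apply HBb; [|exact C4|].
  { repeat (apply Rmult_le_pos; try lra). }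
  intros z Hz; unfold rem; destruct (Hs z Hz) as [H0|H0].
  - rewrite H0; eapply Rle_trans; [apply norm_scal_C|].
    rewrite (norm_zero (K := C_AbsRing) (V := V)) Rmult_0_r.
    repeat (apply Rmult_le_pos; try lra).
  - eapply Rle_trans; [apply norm_scal_C|].
    apply Rmult_le_compat; [apply Cmod_ge_0|apply norm_ge_0| |now apply HMb].
    rewrite !Cmod_mult.
    replace (Cmod h * Cmod h * Cmod h) with (Cmod h ^ 3) by ring.
    apply Rmult_le_compat_l; [exact Hh3|].
    assert (B1 : 0 <= Cmod (/ (z - w)) <= / d).
    { split; [apply Cmod_ge_0|]; rewrite Cmod_inv; [|now apply Csub_neq_0, Hzw].
      apply Rinv_le_contravar; lra. }
    assert (B2 : 0 <= Cmod (/ (z - (w + h))) <= 2 / d).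
    { split; [apply Cmod_ge_0|]; rewrite Cmod_inv; [|now apply Csub_neq_0, Hzh'].
      replace (2 / d) with (/ (d / 2)) by (field; lra).
      apply Rinv_le_contravar; [lra|now apply Hzh]. }
    repeat (apply Rmult_le_compat; try lra; repeat apply Rmult_le_pos; try lra).
Qed.

Lemma cauchy_taylor2 (phi : C -> V) (w : C) (d : R) :
  0 < d -> continuous_along L phi -> supported_off phi w d ->
  taylor2 (cauchy_integral phi) w.
Proof.
  intros Hd Hphi Hs.
  destruct (cauchy_expansion Hd Hphi Hs) as (b & K & _ & H).
  eexists _, b, K, (d / 2); split; [lra|exact H].
Qed.

Lemma cauchy_vanishes (phi : C -> V) :
  continuous_along L phi -> vanishes_at_infinity (cauchy_integral phi).
Proof.
  intros Hphi e He.
  destruct (continuous_along_bounded Hphi) as (M & HM & HMb).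
  destruct (arcs_integral_bound HL) as (B & HB & HBb).
  destruct (arcs_bounded HL) as (N & HN & HNb).
  exists (2 * N + 2 * B * M / e + 1); intros w Hw.
  assert (HBM : 0 <= 2 * B * M / e).
  { apply Rmult_le_pos; [apply Rmult_le_pos; lra|].
    apply Rlt_le, Rinv_0_lt_compat, He. }
  assert (Hdist : forall z, on_arcs L z -> Cmod w / 2 <= Cmod (z - w)).
  { intros z Hz; specialize (HNb z Hz).
    assert (H := Cmod_triangle z (w - z)).
    replace (z + (w - z))%C with w in H by ring.
    replace (w - z)%C with (- (z - w))%C in H by ring.
    rewrite Cmod_opp in H; lra. }
  apply Rle_trans with (B * (2 / Cmod w * M)).
  - apply HBb.
    + apply Rmult_le_pos; [|exact HM]; apply Rlt_le, Rdiv_lt_0_compat; lra.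
    + apply (continuous_along_cauchy (d := Cmod w / 2)); [lra|exact Hphi|].
      intros z Hz; right; now apply Hdist.
    + intros z Hz; eapply Rle_trans; [apply norm_scal_C|].
      apply Rmult_le_compat; [apply Cmod_ge_0|apply norm_ge_0| |now apply HMb].
      specialize (Hdist z Hz); rewrite Cmod_inv; [|apply Cmod_gt_0; lra].
      replace (2 / Cmod w) with (/ (Cmod w / 2)) by (field; lra).
      apply Rinv_le_contravar; lra.
  - apply Rmult_le_reg_r with (Cmod w); [lra|].
    replace (B * (2 / Cmod w * M) * Cmod w) with (2 * B * M) by (field; lra).
    apply Rle_trans with (e * (2 * B * M / e)); [right; field; lra|].
    apply Rmult_le_compat_l; lra.
Qed.

End CauchyIntegral.

(** * The index of a cycle is locally constant *)

Section LocallyConstantIndex.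

Let W := C_CompleteNormedModule.

Lemma is_derive_epsilon (V : NormedModule R_AbsRing) (f : R -> V) (t : R) (l : V) :
  (forall e, 0 < e -> exists d, 0 < d /\ forall s, Rabs (s - t) < d ->
     norm (minus (minus (f s) (f t)) (scal (s - t) l)) <= e * Rabs (s - t)) ->
  is_derive f t l.
Proof.
  intros H; split; [apply is_linear_scal_l|].
  intros x Hx.
  assert (Ht : t = x :> R) by exact (is_filter_lim_locally_unique t x Hx).
  subst x.
  intros e; destruct (H e (cond_pos e)) as (d & Hd & H1).
  exists (mkposreal d Hd); intros s Hs; exact (H1 s Hs).
Qed.

Lemma is_derive_component (f : R -> R) (t l : R) :
  is_derive f t l ->
  forall e, 0 < e -> exists d, 0 < d /\ forall s, Rabs (s - t) < d ->
     Rabs (f s - f t - (s - t) * l) <= e * Rabs (s - t).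
Proof.
  intros [_ H] e He.
  destruct (H t (fun P HP => HP) (mkposreal e He)) as [d Hd].
  exists d; split; [apply cond_pos|]; intros s Hs; exact (Hd s Hs).
Qed.

Lemma is_derive_C (f1 f2 : R -> R) (t l1 l2 : R) :
  is_derive f1 t l1 -> is_derive f2 t l2 ->
  is_derive (V := realify W) (fun s => ((f1 s, f2 s) : C)) t ((l1, l2) : C).
Proof.
  intros H1 H2; apply (is_derive_epsilon (V := realify W)); intros e He.
  destruct (is_derive_component H1 (e := e / 2)) as (d1 & Hd1 & K1); [lra|].
  destruct (is_derive_component H2 (e := e / 2)) as (d2 & Hd2 & K2); [lra|].
  exists (Rmin d1 d2); split; [now apply Rmin_pos|]; intros s Hs.
  specialize (K1 s ltac:(eapply Rlt_le_trans; [exact Hs|apply Rmin_l])).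
  specialize (K2 s ltac:(eapply Rlt_le_trans; [exact Hs|apply Rmin_r])).
  change (Cmod ((f1 s, f2 s) - (f1 t, f2 t) - RtoC (s - t) * (l1, l2))
            <= e * Rabs (s - t)).
  replace ((f1 s, f2 s) - (f1 t, f2 t) - RtoC (s - t) * (l1, l2))%C
    with (RtoC (f1 s - f1 t - (s - t) * l1) +
          Ci * RtoC (f2 s - f2 t - (s - t) * l2))%C.
  - eapply Rle_trans; [apply Cmod_triangle|].
    rewrite Cmod_mult Cmod_Ci !Cmod_R; lra.
  - unfold Cplus, Cminus, Cplus, Copp, Cmult, Ci, RtoC; simpl; f_equal; ring.
Qed.

Lemma C1_arc_components (g : R -> C) (t : R) :
  C1_arc g -> 0 <= t <= 1 ->
  ex_derive (fun s => fst (g s)) t /\ ex_derive (fun s => snd (g s)) t.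
Proof.
  intros Hg Ht; destruct (Hg t Ht) as [[l Hl] _].
  split; [exists (fst l)|exists (snd l)].
  - exact (filterdiff_comp' (U := R_NormedModule) (V := C_R_NormedModule)
      (W := R_NormedModule) g (fun z : C_R_NormedModule => fst z) t
      (fun y => scal y l) (fun z : C_R_NormedModule => fst z) Hl
      (filterdiff_linear _ (is_linear_fst (U := R_NormedModule) (V := R_NormedModule)))).
  - exact (filterdiff_comp' (U := R_NormedModule) (V := C_R_NormedModule)
      (W := R_NormedModule) g (fun z : C_R_NormedModule => snd z) t
      (fun y => scal y l) (fun z : C_R_NormedModule => snd z) Hl
      (filterdiff_linear _ (is_linear_snd (U := R_NormedModule) (V := R_NormedModule)))).
Qed.

Lemma is_derive_inv_arc (g : R -> C) (w : C) (t : R) :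
  C1_arc g -> 0 <= t <= 1 -> g t <> w ->
  is_derive (V := realify W) (fun s => - / (g s - w))%C t
    (velocity g t * (/ (g t - w) * / (g t - w)))%C.
Proof.
  intros Hg Ht Hne; destruct (C1_arc_components Hg Ht) as [Hx Hy].
  set (x := fun s => fst (g s)) in *; set (y := fun s => snd (g s)) in *.
  destruct w as [a b].
  assert (Hn : 0 < (x t - a) ^ 2 + (y t - b) ^ 2).
  { destruct (Req_dec (x t) a) as [H1|H1]; [destruct (Req_dec (y t) b) as [H2|H2]|].
    - exfalso; apply Hne; rewrite -H1 -H2; unfold x, y; now destruct (g t).
    - assert (0 < (y t - b) ^ 2) by (apply pow2_gt_0; lra).
      generalize (pow2_ge_0 (x t - a)); lra.
    - assert (0 < (x t - a) ^ 2) by (apply pow2_gt_0; lra).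
      generalize (pow2_ge_0 (y t - b)); lra. }
  set (D := (x t - a) ^ 2 + (y t - b) ^ 2) in *.
  apply (is_derive_ext (V := realify W) (fun s =>
    (- ((x s - a) / ((x s - a) ^ 2 + (y s - b) ^ 2)),
     (y s - b) / ((x s - a) ^ 2 + (y s - b) ^ 2)) : C)).
  { intros s; unfold Copp, Cinv, Cminus, Cplus, Copp, x, y, Rminus; simpl.
    f_equal; unfold Rdiv; ring. }
  replace (velocity g t * (/ (g t - (a, b)) * / (g t - (a, b))))%C with
    ((- ((Derive x t * D - (x t - a) * (2 * (x t - a) * Derive x t + 2 * (y t - b) * Derive y t)) / D ^ 2),
      (Derive y t * D - (y t - b) * (2 * (x t - a) * Derive x t + 2 * (y t - b) * Derive y t)) / D ^ 2) : C).
  - apply is_derive_C.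
    + auto_derive; [repeat split; trivial; fold D; unfold D in Hn; simpl in Hn; lra|].
      change (Derive (fun x0 : R => x x0) t) with (Derive x t).
      change (Derive (fun x0 : R => y x0) t) with (Derive y t).
      unfold D in *; field; lra.
    + auto_derive; [repeat split; trivial; fold D; unfold D in Hn; simpl in Hn; lra|].
      change (Derive (fun x0 : R => x x0) t) with (Derive x t).
      change (Derive (fun x0 : R => y x0) t) with (Derive y t).
      unfold D in *; field; lra.
  - unfold velocity; fold x y.
    change (fun s => fst (g s)) with x; change (fun s => snd (g s)) with y.
    unfold Cmult, Cinv, Cminus, Cplus, Copp; simpl.
    change (fst (g t)) with (x t); change (snd (g t)) with (y t).
    unfold D in *; simpl in Hn; unfold Rminus in Hn.
    f_equal; field; simpl; unfold Rminus in *; lra.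
Qed.

Lemma arc_integral_inv_sqr (g : R -> C) (w : C) :
  C1_arc g -> (forall t, 0 <= t <= 1 -> g t <> w) ->
  arc_integral (V := W) g (fun z => / (z - w) * / (z - w))%C =
  (/ (g 0 - w) - / (g 1 - w))%C.
Proof.
  intros Hg Hne.
  replace (/ (g 0 - w) - / (g 1 - w))%C
    with (- / (g 1 - w) - - / (g 0 - w))%C by ring.
  apply (is_RInt_unique (V := realify W)).
  apply (is_RInt_derive (V := realify W) (fun s => - / (g s - w))%C
    (fun t => velocity g t * (/ (g t - w) * / (g t - w)))%C);
    intros t Ht; rewrite Rmin_left in Ht; try lra; rewrite Rmax_right in Ht; try lra.
  - now apply is_derive_inv_arc; [| |apply Hne].
  - assert (Hc : @continuous _ C_UniformSpace (fun s => / (g s - w))%C t).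
    { apply (continuous_comp g (fun z => / (z - w))%C).
      - destruct (Hg t Ht) as [H _]; exact (ex_derive_continuous _ _ H).
      - apply continuous_inv_sub; now apply Hne. }
    apply continuous_Cmult; [apply Hg; exact Ht|now apply continuous_Cmult].
Qed.

(** The function [1 / (z - w)^2] has the primitive [- 1 / (z - w)]. *)
Lemma closed_path_inv_sqr (path : list (R -> C)) (w : C) :
  closed_path path -> (forall z, on_arcs path z -> z <> w) ->
  arcs_integral (V := W) path (fun z => / (z - w) * / (z - w))%C = RtoC 0.
Proof.
  intros [[z Hz] Hpath] Hne.
  assert (H : forall path z1 z2, List.Forall C1_arc path ->
    (forall z, on_arcs path z -> z <> w) -> joins z1 path z2 ->
    arcs_integral (V := W) path (fun z => / (z - w) * / (z - w))%C =
    (/ (z1 - w) - / (z2 - w))%C).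
  { clear; induction path as [|g path IH]; intros z1 z2 HF Hne Hj.
    - simpl in Hj; subst z2; simpl; change (zero : C) with (RtoC 0); ring.
    - destruct Hj as [Hz1 Hj]; inversion_clear HF as [|? ? Hg HF'].
      assert (Hne1 : forall t, 0 <= t <= 1 -> g t <> w).
      { intros t Ht; apply Hne; exists g, t; split; [now left|auto]. }
      assert (Hne2 : forall z, on_arcs path z -> z <> w).
      { intros z (g' & t & Hin & Ht & ->); apply Hne; exists g', t; split; [now right|auto]. }
      simpl; rewrite (IH _ _ HF' Hne2 Hj) (arc_integral_inv_sqr Hg Hne1) Hz1.
      change (@eq C (/ (z1 - w) - / (g 1 - w) + (/ (g 1 - w) - / (z2 - w)))%C
        (/ (z1 - w) - / (z2 - w))%C); ring. }
  rewrite (H path z z Hpath Hne Hz); exact (Cplus_opp_r _).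
Qed.

Lemma arcs_integral_app (V : CompleteNormedModule C_AbsRing)
    (L L' : list (R -> C)) (f : C -> V) :
  arcs_integral (L ++ L') f = plus (arcs_integral L f) (arcs_integral L' f).
Proof.
  induction L as [|g L IH]; simpl; [now rewrite plus_zero_l|].
  rewrite IH; apply (plus_assoc (G := V)).
Qed.

Lemma cycle_inv_sqr (G : list (list (R -> C))) (w : C) :
  cycle G -> (forall z, on_cycle G z -> z <> w) ->
  arcs_integral (V := W) (concat G) (fun z => / (z - w) * / (z - w))%C = RtoC 0.
Proof.
  induction G as [|path G IH]; intros HG Hne; [reflexivity|].
  inversion_clear HG as [|? ? Hp HG']; simpl; rewrite arcs_integral_app.
  assert (Hne1 : forall z, on_arcs path z -> z <> w).
  { intros z (g & t & Hin & Ht & ->); apply Hne; exists g, t.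
    split; [apply in_or_app; now left|auto]. }
  assert (Hne2 : forall z, on_cycle G z -> z <> w).
  { intros z (g & t & Hin & Ht & ->); apply Hne; exists g, t.
    split; [apply in_or_app; now right|auto]. }
  rewrite (closed_path_inv_sqr Hp Hne1) (IH HG' Hne2).
  exact (Cplus_0_l (RtoC 0)).
Qed.

Lemma cycle_C1_arcs (G : list (list (R -> C))) :
  cycle G -> List.Forall C1_arc (concat G).
Proof.
  induction 1 as [|path G [_ Hp] _ IH]; [constructor|].
  simpl; apply List.Forall_app; auto.
Qed.

(** This is [2 pi i] times the winding number; see [index_winding]. *)
Definition index_integral (L : list (R -> C)) (w : C) : C :=
  cauchy_integral (V := W) L (fun _ => RtoC 1) w.

Lemma continuous_along_const (V : CompleteNormedModule C_AbsRing)
    (L : list (R -> C)) (v : V) : continuous_along L (fun _ => v).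
Proof. intros g t _; apply continuous_const. Qed.

(** The derivative of the index is the integral of [1 / (z - w)^2], which is zero
    on a cycle. *)
Lemma index_locally_constant (G : list (list (R -> C))) (a : C) (d : R) :
  cycle G -> 0 < d -> (forall z, on_cycle G z -> d <= Cmod (z - a)) ->
  forall h, Cmod h < d / 2 ->
    index_integral (concat G) (a + h)%C = index_integral (concat G) a.
Proof.
  intros HG Hd Hdist h Hh.
  assert (HL := cycle_C1_arcs HG).
  set (f := fun s => index_integral (concat G) (a + RtoC s * h)%C).
  assert (Hf : f 0 = f 1 :> C).
  { apply (eq_is_derive (V := realify W) f 0 1); [|lra]; intros t Ht.
    set (w := (a + RtoC t * h)%C).
    assert (Hth : Cmod (RtoC t * h) <= Cmod h).
    { rewrite Cmod_mult Cmod_R Rabs_pos_eq; [|lra].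
      generalize (Cmod_ge_0 h); nra. }
    assert (Hw : forall z, on_cycle G z -> d / 2 <= Cmod (z - w)).
    { intros z Hz; specialize (Hdist z Hz).
      assert (H := Cmod_sub_shift z a (RtoC t * h)); unfold w; lra. }
    assert (Hd2 : 0 < d / 2) by lra.
    destruct (cauchy_expansion (V := W) HL (phi := fun _ => RtoC 1) (w := w) Hd2)
      as (b & K & HK & H).
    { apply (continuous_along_const (V := W)). }
    { intros z Hz; right; now apply Hw. }
    assert (Hz : arcs_integral (V := W) (concat G) (fun z =>
      scal (/ (z - w) * / (z - w) : C_AbsRing)%C (RtoC 1 : W)) = zero).
    { assert (Hne : forall z, on_cycle G z -> z <> w).
      { intros z Hz; apply Cmod_pos_neq; specialize (Hw z Hz); lra. }
      change (zero : W) with (RtoC 0); rewrite -(cycle_inv_sqr HG Hne).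
      apply (arcs_integral_ext (V := W)); intros z _; apply Cmult_1_r. }
    rewrite Hz in H; clear Hz.
    apply (is_derive_epsilon (V := realify W)); intros e He.
    set (c := (Cmod b + K + 1) * (Cmod h + 1) ^ 3).
    assert (Hh0 := Cmod_ge_0 h); assert (Hb0 := Cmod_ge_0 b).
    assert (Hc : 0 < c).
    { unfold c; apply Rmult_lt_0_compat; [lra|apply pow_lt; lra]. }
    exists (Rmin 1 (Rmin (d / 4 / (Cmod h + 1)) (e / c))); split.
    { repeat apply Rmin_pos; [lra| |now apply Rdiv_lt_0_compat].
      apply Rdiv_lt_0_compat; lra. }
    intros s Hs.
    assert (Hs1 : Rabs (s - t) < 1) by (eapply Rlt_le_trans; [exact Hs|apply Rmin_l]).
    assert (Hs' : Rabs (s - t) < Rmin (d / 4 / (Cmod h + 1)) (e / c))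
      by (eapply Rlt_le_trans; [exact Hs|apply Rmin_r]).
    assert (Hs2 : Rabs (s - t) < d / 4 / (Cmod h + 1))
      by (eapply Rlt_le_trans; [exact Hs'|apply Rmin_l]).
    assert (Hs3 : Rabs (s - t) < e / c)
      by (eapply Rlt_le_trans; [exact Hs'|apply Rmin_r]).
    assert (Hr := Rabs_pos (s - t)); set (r := Rabs (s - t)) in *.
    set (k := (RtoC (s - t) * h)%C).
    assert (Hk : Cmod k = r * Cmod h) by (unfold k; rewrite Cmod_mult Cmod_R; reflexivity).
    assert (Hk2 : Cmod k < d / 2 / 2).
    { rewrite Hk; apply Rle_lt_trans with (r * (Cmod h + 1)); [nra|].
      replace (d / 2 / 2) with (d / 4 / (Cmod h + 1) * (Cmod h + 1)) by (field; lra).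
      apply Rmult_lt_compat_r; lra. }
    specialize (H k Hk2).
    change (Cmod (f s - f t - RtoC (s - t) * RtoC 0) <= e * r).
    change (Cmod (index_integral (concat G) (w + k)%C -
      (index_integral (concat G) w + (k * RtoC 0 + k * k * b)))
      <= K * Cmod k ^ 3) in H.
    assert (Hfs : f s = index_integral (concat G) (w + k)%C).
    { unfold f; f_equal; unfold w, k; rewrite RtoC_minus; ring. }
    change (index_integral (concat G) w) with (f t) in H; rewrite -Hfs in H.
    replace (f s - f t - RtoC (s - t) * RtoC 0)%C
      with ((f s - (f t + (k * RtoC 0 + k * k * b))) + k * k * b)%C by ring.
    eapply Rle_trans; [apply Cmod_triangle|].
    rewrite (Cmod_mult (k * k) b) (Cmod_mult k k).
    apply Rle_trans with (c * r ^ 2).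
    - rewrite Hk in H |- *.
      assert (E1 : K * (r * Cmod h) ^ 3 <= K * (Cmod h + 1) ^ 3 * r ^ 2).
      { replace (K * (r * Cmod h) ^ 3) with (K * (Cmod h ^ 3 * r * r ^ 2)) by ring.
        rewrite (Rmult_assoc K); apply Rmult_le_compat_l; [exact HK|].
        apply Rmult_le_compat_r; [apply pow2_ge_0|].
        apply Rle_trans with (Cmod h ^ 3).
        - assert (0 <= Cmod h ^ 3) by now apply pow_le. nra.
        - apply pow_incr; lra. }
      assert (E2 : r * Cmod h * (r * Cmod h) * Cmod b <=
                   Cmod b * (Cmod h + 1) ^ 3 * r ^ 2).
      { replace (r * Cmod h * (r * Cmod h) * Cmod b)
          with (Cmod b * (Cmod h ^ 2 * r ^ 2)) by ring.
        rewrite (Rmult_assoc (Cmod b)); apply Rmult_le_compat_l; [exact Hb0|].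
        apply Rmult_le_compat_r; [apply pow2_ge_0|].
        apply Rle_trans with ((Cmod h + 1) ^ 2); [apply pow_incr; lra|].
        apply Rle_pow; [lra|lia]. }
      assert (E3 : 0 <= (Cmod h + 1) ^ 3 * r ^ 2).
      { apply Rmult_le_pos; [apply pow_le; lra|apply pow2_ge_0]. }
      unfold c; lra.
    - replace (c * r ^ 2) with ((c * r) * r) by ring.
      apply Rmult_le_compat_r; [exact Hr|].
      apply Rlt_le, Rmult_lt_reg_r with (/ c); [now apply Rinv_0_lt_compat|].
      replace (c * r * / c) with r by (field; lra); exact Hs3. }
  unfold f in Hf.
  replace (a + RtoC 0 * h)%C with a in Hf by ring.
  replace (a + RtoC 1 * h)%C with (a + h)%C in Hf by ring.
  now rewrite Hf.
Qed.

End LocallyConstantIndex.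

(** * Resolvents *)

Section Resolvents.

Variable X : CompleteNormedModule C_AbsRing.

(** The sum of the Neumann series [x + T x + T^2 x + ...], whose partial sums [s_n]
    satisfy [s_n - T s_n = x - T^(n+1) x]. *)
Lemma neumann_solve (T : X -> X) (x : X) :
  is_linear T -> (forall v, norm (T v) <= / 2 * norm v) ->
  exists v, minus v (T v) = x.
Proof.
  intros HT Hc.
  set (a := fun n => Nat.iter n T x).
  assert (Ha : forall n, norm (a n) <= (/ 2) ^ n * norm x).
  { induction n as [|n IH]; [simpl; lra|].
    change (a (S n)) with (T (a n)); simpl.
    eapply Rle_trans; [apply Hc|]; lra. }
  destruct (ex_series_le (K := C_AbsRing) (V := X) a (fun n => (/ 2) ^ n * norm x) Ha)
    as [v Hv].
  { apply ex_series_scal_r, ex_series_geom; rewrite Rabs_pos_eq; lra. }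
  assert (Hsum : forall n, minus (sum_n a n) (T (sum_n a n)) = minus x (a (S n))).
  { induction n as [|n IH]; [now rewrite sum_O|].
    rewrite sum_Sn (linear_plus T HT).
    change (T (a (S n))) with (a (S (S n))).
    transitivity (plus (minus (sum_n a n) (T (sum_n a n)))
                       (minus (a (S n)) (a (S (S n))))).
    - module_eq X; ring.
    - rewrite IH; module_eq X; ring. }
  exists v; apply minus_eq_0, norm_eq_0, le_epsilon; intros e He.
  assert (H1 : eventually (fun n => norm (minus (sum_n a n) v) < e / 4)).
  { apply (Hv (fun u => norm (minus u v) < e / 4)).
    apply (locally_le_locally_norm (K := C_AbsRing) (V := X) v).
    assert (He4 : 0 < e / 4) by lra.
    exists (mkposreal _ He4); intros y Hy; exact Hy. }
  destruct H1 as [N1 H1].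
  destruct (pow_lt_1_zero (/ 2)) with (y := e / (2 * (norm x + 1))) as [N2 H2].
  { rewrite Rabs_pos_eq; lra. }
  { apply Rdiv_lt_0_compat; [lra|]; generalize (norm_ge_0 x); lra. }
  set (n := (N1 + N2)%nat).
  specialize (H1 n ltac:(unfold n; lia)).
  specialize (H2 (S n) ltac:(unfold n; lia)).
  rewrite Rabs_pos_eq in H2; [|apply pow_le; lra].
  set (s := sum_n a n) in *.
  match goal with |- norm ?t <= _ => replace t with
    (plus (minus (T (minus s v)) (minus s v)) (opp (a (S n)))) end.
  - eapply Rle_trans; [apply norm_plus_le|].
    assert (H5 : norm (opp (a (S n))) = norm (a (S n)))
      by exact (norm_opp (K := C_AbsRing) (V := X) (a (S n))).
    eapply Rle_trans;
      [apply Rplus_le_compat; [apply norm_minus_le|exact (Req_le _ _ H5)]|].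
    assert (H3 := Hc (minus s v)); assert (H4 := Ha (S n)).
    assert (H6 : (/ 2) ^ S n * norm x <= e / 2).
    { assert (Hx := norm_ge_0 x).
      apply Rle_trans with (e / (2 * (norm x + 1)) * (norm x + 1)).
      - apply Rmult_le_compat; [apply pow_le; lra|exact Hx|now apply Rlt_le|lra].
      - right; field; lra. }
    lra.
  - rewrite (linear_minus T s v HT).
    transitivity (minus (plus (minus v (T v)) (opp x))
      (plus (minus (minus s (T s)) (minus x (a (S n)))) zero)).
    + module_eq X; ring.
    + rewrite /s Hsum; module_eq X; ring.
Qed.

Lemma half_contraction_injective (T : X -> X) (u v : X) :
  is_linear T -> (forall v, norm (T v) <= / 2 * norm v) ->
  minus u (T u) = minus v (T v) -> u = v.
Proof.
  intros HT Hc Heq; apply minus_eq_0, norm_eq_0.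
  assert (H : minus u v = T (minus u v)).
  { rewrite (linear_minus T u v HT).
    transitivity (plus (minus u (T u)) (minus (T u) v)); [module_eq X; ring|].
    rewrite Heq; module_eq X; ring. }
  assert (H1 := Hc (minus u v)); rewrite -H in H1; lra.
Qed.

(** Solutions being unique, the one chosen for each right-hand side depends
    linearly on it. *)
Lemma neumann (T : X -> X) :
  is_linear T -> (forall v, norm (T v) <= / 2 * norm v) ->
  exists N : X -> X, is_linear N /\
    (forall v, N (minus v (T v)) = v) /\
    (forall v, minus (N v) (T (N v)) = v) /\
    (forall v, norm (N v) <= 2 * norm v).
Proof.
  intros HT Hc.
  set (N := fun x => proj1_sig
    (constructive_indefinite_description _ (neumann_solve x HT Hc))).
  assert (HN : forall x, minus (N x) (T (N x)) = x) by (intros x;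
    exact (proj2_sig (constructive_indefinite_description _ (neumann_solve x HT Hc)))).
  clearbody N.
  assert (Hb : forall v, norm (N v) <= 2 * norm v).
  { intros v.
    assert (H : norm (N v) <= norm v + / 2 * norm (N v)); [|lra].
    replace (N v) with (plus (minus (N v) (T (N v))) (T (N v))) at 1
      by (module_eq X; ring).
    rewrite HN; eapply Rle_trans; [apply norm_plus_le|].
    apply Rplus_le_compat_l, Hc. }
  exists N; split; [split|split; [|split; [exact HN|exact Hb]]].
  - intros x y; apply (half_contraction_injective HT Hc); rewrite HN.
    rewrite (linear_plus T HT).
    transitivity (plus (minus (N x) (T (N x))) (minus (N y) (T (N y)))).
    + now rewrite !HN.
    + module_eq X; ring.
  - intros k x; apply (half_contraction_injective HT Hc); rewrite HN.
    rewrite (linear_scal T HT) -{1}(HN x); module_eq X; ring.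
  - exists 2; split; [lra|exact Hb].
  - intros v; apply (half_contraction_injective HT Hc); now rewrite HN.
Qed.

Variable A : X -> X.
Hypothesis HA : is_linear A.

Lemma resolvent_spec (z : C) : ~ spectrum A z -> is_resolvent A z (resolvent A z).
Proof. intros H; exact (epsilon_spec _ _ (NNPP _ H)). Qed.

Lemma resolvent_unique (z : C) (S : X -> X) :
  is_resolvent A z S -> forall v, resolvent A z v = S v.
Proof.
  intros HS v.
  assert (Hz : ~ spectrum A z) by (intros H; apply H; now exists S).
  destruct (resolvent_spec Hz) as (_ & Hl & _); destruct HS as (_ & _ & Hr).
  rewrite -{1}(Hr v); apply Hl.
Qed.

(** Factor [w + h - A = (1 + h S) (w - A)]. *)
Lemma resolvent_perturb (w h : C) (S : X -> X) (c : R) :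
  is_resolvent A w S -> (forall v, norm (S v) <= c * norm v) ->
  Cmod h * c <= / 2 ->
  exists S', is_resolvent A (w + h)%C S' /\ forall v, norm (S' v) <= 2 * c * norm v.
Proof.
  intros (HS & Hl & Hr) Hc Hh.
  destruct (@neumann (fun v : X => scal (- h : C_AbsRing)%C (S v))) as (N & HN & Nl & Nr & Nb).
  - exact (is_linear_comp _ _ HS (is_linear_scal X (- h)%C)).
  - intros v; eapply Rle_trans; [apply norm_scal_C|].
    rewrite Cmod_opp.
    apply Rle_trans with (Cmod h * (c * norm v)).
    + apply Rmult_le_compat_l; [apply Cmod_ge_0|apply Hc].
    + rewrite -Rmult_assoc; apply Rmult_le_compat_r; [apply norm_ge_0|exact Hh].
  - assert (Hc0 : forall v : X, 0 <= c * norm v).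
    { intros v; eapply Rle_trans; [|apply Hc]; apply norm_ge_0. }
    exists (fun v => S (N v)); split; [split; [|split]|].
    + exact (is_linear_comp _ _ HN HS).
    + intros v; rewrite -[RHS](Hl v).
      set (u := minus (scal (w : C_AbsRing) v) (A v)).
      assert (Hu : S u = v) by exact (Hl v).
      replace (minus (scal ((w + h)%C : C_AbsRing) v) (A v))
        with (minus u (scal (- h : C_AbsRing)%C (S u))).
      * now rewrite Nl.
      * rewrite Hu; unfold u; module_eq X; ring.
    + intros v.
      transitivity (plus (minus (scal (w : C_AbsRing) (S (N v))) (A (S (N v))))
                         (scal (h : C_AbsRing) (S (N v)))); [module_eq X; ring|].
      rewrite Hr -[RHS](Nr v); module_eq X; ring.
    + intros v; eapply Rle_trans; [apply Hc|].
      assert (H := Nb v); assert (H2 := norm_ge_0 v).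
      destruct (Rle_lt_dec 0 c) as [Hcp|Hcn].
      * replace (2 * c * norm v) with (c * (2 * norm v)) by ring.
        now apply Rmult_le_compat_l.
      * assert (H3 := Hc0 v); assert (H4 := Hc0 (N v)).
        assert (H5 := norm_ge_0 (N v)); nra.
Qed.

Lemma resolvent_expand (w h : C) (x : X) :
  ~ spectrum A w -> ~ spectrum A (w + h)%C ->
  resolvent A (w + h)%C x =
  minus (resolvent A w x) (scal (h : C_AbsRing) (resolvent A w (resolvent A (w + h)%C x))).
Proof.
  intros Hw Hwh.
  destruct (resolvent_spec Hw) as (HS & Hl & _).
  destruct (resolvent_spec Hwh) as (_ & _ & Hr).
  set (S := resolvent A w) in *; set (y := resolvent A (w + h)%C x).
  rewrite -{1}(Hr x); fold y.
  replace (minus (scal ((w + h)%C : C_AbsRing) y) (A y))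
    with (plus (minus (scal (w : C_AbsRing) y) (A y)) (scal (h : C_AbsRing) y))
    by (module_eq X; ring).
  rewrite (linear_plus S HS) Hl (linear_scal S HS); module_eq X; ring.
Qed.

Lemma resolvent_set_open (w : C) :
  ~ spectrum A w -> exists d c, 0 < d /\ 0 < c /\
    forall h, Cmod h < d -> ~ spectrum A (w + h)%C /\
      forall x, norm (resolvent A w x) <= c * norm x /\
                norm (resolvent A (w + h)%C x) <= 2 * c * norm x.
Proof.
  intros Hw; assert (HS := resolvent_spec Hw).
  destruct (linear_norm _ (proj1 HS)) as (c & Hc & Hb).
  exists (/ (2 * c)), c; split; [apply Rinv_0_lt_compat; lra|split; [exact Hc|]].
  intros h Hh.
  destruct (@resolvent_perturb w h _ c HS Hb) as (S' & HS' & Hb').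
  - apply Rlt_le, Rmult_lt_reg_r with (/ c); [now apply Rinv_0_lt_compat|].
    replace (Cmod h * c * / c) with (Cmod h) by (field; lra).
    replace (/ 2 * / c) with (/ (2 * c)) by (field; lra); exact Hh.
  - split; [intros H; apply H; now exists S'|]; intros x; split; [apply Hb|].
    rewrite (resolvent_unique HS'); apply Hb'.
Qed.

(** Iterating [resolvent_expand] three times gives the expansion, with the
    remainder [- h^3 R(w)^3 R(w+h) x]. *)
Lemma resolvent_taylor2 (w : C) (x : X) :
  ~ spectrum A w -> taylor2 (fun z => resolvent A z x) w.
Proof.
  intros Hw; destruct (resolvent_set_open Hw) as (d & c & Hd & Hc & H).
  set (S := resolvent A w).
  assert (HS : is_linear S) by exact (proj1 (resolvent_spec Hw)).
  exists (opp (S (S x))), (S (S (S x))), (c * (c * (c * (2 * c * norm x)))), d.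
  split; [exact Hd|]; intros h Hh; destruct (H h Hh) as [Hwh Hb].
  set (y := resolvent A (w + h)%C x).
  assert (Hy : y = minus (S x) (scal (h : C_AbsRing) (S y)))
    by exact (resolvent_expand x Hw Hwh).
  assert (Hy1 : S y = minus (S (S x)) (scal (h : C_AbsRing) (S (S y)))).
  { rewrite {1}Hy (linear_minus S _ _ HS) (linear_scal S HS); reflexivity. }
  assert (Hy2 : S (S y) = minus (S (S (S x))) (scal (h : C_AbsRing) (S (S (S y))))).
  { rewrite {1}Hy1 (linear_minus S _ _ HS) (linear_scal S HS); reflexivity. }
  assert (Hy3 : minus y (plus (S x) (plus (scal (h : C_AbsRing) (opp (S (S x))))
      (scal ((h * h)%C : C_AbsRing) (S (S (S x)))))) =
      scal (- (h * h * h) : C_AbsRing)%C (S (S (S y)))).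
  { generalize dependent (S (S (S y))); intros y3 Hy2.
    rewrite {1}Hy Hy1 Hy2; module_eq X; ring. }
  rewrite Hy3; eapply Rle_trans; [apply norm_scal_C|].
  rewrite Cmod_opp !Cmod_mult.
  rewrite Rmult_comm; apply Rmult_le_compat;
    [apply norm_ge_0| |  |right; ring].
  { repeat apply Rmult_le_pos; apply Cmod_ge_0. }
  eapply Rle_trans; [apply Hb|]; apply Rmult_le_compat_l; [lra|].
  eapply Rle_trans; [apply Hb|]; apply Rmult_le_compat_l; [lra|].
  eapply Rle_trans; [apply Hb|]; apply Rmult_le_compat_l; [lra|apply Hb].
Qed.

Lemma resolvent_far :
  exists c, 0 < c /\ forall w, c <= Cmod w -> ~ spectrum A w /\
    forall x, norm (resolvent A w x) <= 2 / Cmod w * norm x.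
Proof.
  destruct (linear_norm _ HA) as (c & Hc & Hb).
  exists (2 * c); split; [lra|]; intros w Hw.
  assert (Hw0 : w <> RtoC 0) by (apply Cmod_gt_0; lra).
  destruct (@neumann (fun v : X => scal (/ w : C_AbsRing)%C (A v))) as (N & HN & Nl & Nr & Nb).
  - exact (is_linear_comp _ _ HA (is_linear_scal X (/ w)%C)).
  - intros v; eapply Rle_trans; [apply norm_scal_C|].
    rewrite (Cmod_inv _ Hw0).
    apply Rle_trans with (/ (2 * c) * (c * norm v)).
    + apply Rmult_le_compat; [|apply norm_ge_0| |apply Hb].
      * apply Rlt_le, Rinv_0_lt_compat; lra.
      * apply Rinv_le_contravar; lra.
    + right; field; lra.
  - assert (HS : is_resolvent A w (fun v => scal (/ w : C_AbsRing)%C (N v))).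
    { split; [|split].
      - exact (is_linear_comp _ _ HN (is_linear_scal X (/ w)%C)).
      - intros v; rewrite -[RHS](Nl v).
        replace (minus (scal (w : C_AbsRing) v) (A v))
          with (scal (w : C_AbsRing) (minus v (scal (/ w : C_AbsRing)%C (A v))))
          by (module_eq X; now field).
        rewrite (linear_scal N HN); module_eq X; now field.
      - intros v; rewrite (linear_scal A HA) -[RHS](Nr v); module_eq X; now field. }
    split; [intros H; apply H; eexists; exact HS|].
    intros x; rewrite (resolvent_unique HS).
    eapply Rle_trans; [apply norm_scal_C|].
    rewrite (Cmod_inv _ Hw0); unfold Rdiv.
    rewrite (Rmult_comm 2) Rmult_assoc; apply Rmult_le_compat_l; [|apply Nb].
    apply Rlt_le, Rinv_0_lt_compat; lra.
Qed.

Lemma resolvent_identity (z w : C) (x : X) :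
  ~ spectrum A z -> ~ spectrum A w -> z <> w ->
  resolvent A w (resolvent A z x) =
  scal (/ (z - w) : C_AbsRing)%C (minus (resolvent A w x) (resolvent A z x)).
Proof.
  intros Hz Hw Hne.
  assert (H0 := Csub_neq_0 Hne).
  assert (H : resolvent A (w + (z - w))%C x = minus (resolvent A w x)
    (scal ((z - w)%C : C_AbsRing) (resolvent A w (resolvent A (w + (z - w))%C x)))).
  { apply resolvent_expand; [exact Hw|]; now replace (w + (z - w))%C with z by ring. }
  replace (w + (z - w))%C with z in H by ring.
  rewrite {2}H; module_eq X; now field.
Qed.

End Resolvents.

(** * Integrals of the resolvent *)

Section RieszProjection.

Variable X : CompleteNormedModule C_AbsRing.
Variable A : X -> X.
Hypothesis HA : is_linear A.

Let W := C_CompleteNormedModule.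

Lemma is_linear_scal_vector (v : X) :
  is_linear (U := W) (fun k => scal (k : C_AbsRing) v).
Proof.
  destruct (is_linear_scal_l (K := C_AbsRing) (V := X) v) as [H1 H2 H3].
  split; [exact H1|exact H2|exact H3].
Qed.

Lemma continuous_along_scal (L : list (R -> C)) (k : C -> C) (f : C -> X) :
  continuous_along (V := W) L k -> continuous_along L f ->
  continuous_along L (fun z => scal (k z : C_AbsRing) (f z)).
Proof.
  intros Hk Hf g t Hin; apply (continuous_scal (K := C_AbsRing) (V := X)
    (fun s => k (g (clamp s))) (fun s => f (g (clamp s)))).
  - apply continuous_C_AbsRing; now apply Hk.
  - now apply Hf.
Qed.

Lemma continuous_along_resolvent (L : list (R -> C)) (x : X) :
  List.Forall C1_arc L -> (forall z, on_arcs L z -> ~ spectrum A z) ->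
  continuous_along L (fun z => resolvent A z x).
Proof.
  intros HL Hz g t Hin.
  apply (continuous_comp (fun s => g (clamp s)) (fun z => resolvent A z x)).
  - apply C1_arc_continuous; exact (proj1 (List.Forall_forall _ _) HL g Hin).
  - apply taylor2_continuous, resolvent_taylor2, Hz.
    exists g, (clamp t); auto using clamp_range.
Qed.

(** Apply [(w - A)^-1] under the integral sign, and use the resolvent identity. *)
Lemma resolvent_cauchy (L : list (R -> C)) (psi : C -> C) (w : C) (d : R) (x : X) :
  List.Forall C1_arc L -> continuous_along (V := W) L psi ->
  (forall z, on_arcs L z -> ~ spectrum A z) ->
  ~ spectrum A w -> 0 < d -> (forall z, on_arcs L z -> d <= Cmod (z - w)) ->
  resolvent A w (arcs_integral L (fun z => scal (psi z : C_AbsRing) (resolvent A z x)))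
  = minus (scal (cauchy_integral (V := W) L psi w : C_AbsRing) (resolvent A w x))
      (cauchy_integral L (fun z => scal (psi z : C_AbsRing) (resolvent A z x)) w).
Proof.
  intros HL Hpsi HLz Hw Hd Hdist.
  assert (HS := proj1 (resolvent_spec Hw)).
  set (phi := fun z => scal (psi z : C_AbsRing) (resolvent A z x)).
  assert (Hphi : continuous_along L phi)
    by (apply continuous_along_scal; [exact Hpsi|now apply continuous_along_resolvent]).
  rewrite -(arcs_integral_linear HS HL Hphi).
  assert (C1 : continuous_along (V := W) L (fun z => scal (/ (z - w) : C_AbsRing)%C (psi z : W))).
  { apply (continuous_along_cauchy (V := W) HL Hd Hpsi); intros z Hz; right; auto. }
  assert (C2 : continuous_along L (fun z => scal (/ (z - w) : C_AbsRing)%C (phi z))).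
  { apply (continuous_along_cauchy HL Hd Hphi); intros z Hz; right; auto. }
  unfold cauchy_integral.
  rewrite -(arcs_integral_linear (is_linear_scal_vector (resolvent A w x)) HL C1).
  assert (C1' := continuous_along_linear (is_linear_scal_vector (resolvent A w x)) C1).
  assert (C2' := continuous_along_linear (is_linear_scal X (RtoC (-1))) C2).
  simpl in C1', C2'.
  transitivity (plus (arcs_integral L (fun z =>
      scal (scal (/ (z - w) : C_AbsRing)%C (psi z : W) : C_AbsRing) (resolvent A w x)))
    (arcs_integral L (fun z => scal (RtoC (-1) : C_AbsRing)
       (scal (/ (z - w) : C_AbsRing)%C (phi z))))).
  - rewrite -(arcs_integral_plus HL C1' C2').
    apply arcs_integral_ext; intros z Hz; unfold phi.
    rewrite (linear_scal _ HS).
    assert (Hne : z <> w) by (apply Cmod_pos_neq; specialize (Hdist z Hz); lra).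
    rewrite (resolvent_identity x (HLz z Hz) Hw Hne).
    change (scal (/ (z - w) : C_AbsRing)%C (psi z : W)) with (/ (z - w) * psi z)%C.
    module_eq X; ring.
  - rewrite (arcs_integral_scal _ HL C2); module_eq X; ring.
Qed.

(** For [u] the difference of the two sides, [F] glues the local resolvent
    [(w - A)^-1 u] with the Cauchy integral that continues it across the
    spectrum.  By Liouville's theorem [F = 0], and [u = 0] follows since the
    resolvent is injective at a point outside the spectrum. *)
Theorem riesz_integral (L : list (R -> C)) (psi : C -> C) (c : C) (x : X) :
  List.Forall C1_arc L -> continuous_along (V := W) L psi ->
  (forall z, on_arcs L z -> ~ spectrum A z) ->
  (forall a, spectrum A a -> exists d, 0 < d /\
     (forall z, on_arcs L z -> d <= Cmod (z - a)) /\
     forall h, Cmod h < d -> cauchy_integral (V := W) L psi (a + h)%C = c) ->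
  arcs_integral L (fun z => scal (psi z : C_AbsRing) (resolvent A z x)) =
  scal (c : C_AbsRing) x.
Proof.
  intros HL Hpsi HLz Hind.
  set (phi := fun z => scal (psi z : C_AbsRing) (resolvent A z x)).
  assert (Hphi : continuous_along L phi)
    by (apply continuous_along_scal; [exact Hpsi|now apply continuous_along_resolvent]).
  set (u := minus (scal (c : C_AbsRing) x) (arcs_integral L phi) : X).
  set (F := fun w => match excluded_middle_informative (spectrum A w) with
                     | left _ => cauchy_integral L phi w
                     | right _ => resolvent A w u
                     end).
  assert (Hnear : forall a d h, spectrum A a -> 0 < d ->
     (forall z, on_arcs L z -> d <= Cmod (z - a)) ->
     (forall h, Cmod h < d -> cauchy_integral (V := W) L psi (a + h)%C = c) ->
     Cmod h < d -> F (a + h)%C = cauchy_integral L phi (a + h)%C).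
  { intros a d h Ha Hd Hdist Hc Hh; unfold F.
    destruct (excluded_middle_informative (spectrum A (a + h)%C)) as [Hs|Hs]; [reflexivity|].
    assert (HS := proj1 (resolvent_spec Hs)).
    unfold u; rewrite (linear_minus _ _ _ HS) (linear_scal _ HS).
    assert (Hd' : 0 < d - Cmod h) by lra.
    assert (Hdist' : forall z, on_arcs L z -> d - Cmod h <= Cmod (z - (a + h))).
    { intros z Hz; specialize (Hdist z Hz).
      assert (H := Cmod_sub_shift z a h); lra. }
    unfold phi at 1; rewrite (resolvent_cauchy x HL Hpsi HLz Hs Hd' Hdist').
    rewrite (Hc h Hh); fold phi; module_eq X; ring. }
  assert (HF : forall w, F w = zero).
  { apply liouville.
    - intros w; destruct (excluded_middle_informative (spectrum A w)) as [Hs|Hs].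
      + destruct (Hind w Hs) as (d & Hd & Hdist & Hc).
        apply (taylor2_ext_loc (G := cauchy_integral L phi) Hd).
        * intros h Hh; now apply (Hnear w d).
        * apply (cauchy_taylor2 HL Hd Hphi); intros z Hz; right; auto.
      + destruct (resolvent_set_open Hs) as (d & k & Hd & _ & H).
        apply (taylor2_ext_loc (G := fun z => resolvent A z u) Hd).
        * intros h Hh; unfold F.
          destruct (excluded_middle_informative (spectrum A (w + h)%C)) as [Hs'|Hs'];
            [|reflexivity].
          now destruct (proj1 (H h Hh)).
        * now apply resolvent_taylor2.
    - intros e He; destruct (resolvent_far HA) as (k & Hk & Hfar).
      assert (Hu := norm_ge_0 u).
      exists (k + 2 * norm u / e); intros w Hw.
      assert (H0 : 0 <= 2 * norm u / e).
      { apply Rmult_le_pos; [lra|]; now apply Rlt_le, Rinv_0_lt_compat. }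
      destruct (Hfar w) as [Hs Hb]; [lra|]; unfold F.
      destruct (excluded_middle_informative (spectrum A w)) as [Hs'|_]; [now destruct Hs|].
      eapply Rle_trans; [apply Hb|].
      apply Rmult_le_reg_r with (Cmod w); [lra|].
      replace (2 / Cmod w * norm u * Cmod w) with (e * (2 * norm u / e)) by (field; lra).
      apply Rmult_le_compat_l; lra. }
  destruct (resolvent_far HA) as (k & Hk & Hfar).
  destruct (Hfar (RtoC k)) as [Hs _].
  { rewrite Cmod_R Rabs_pos_eq; lra. }
  assert (Hu : resolvent A (RtoC k) u = zero).
  { rewrite -(HF (RtoC k)); unfold F.
    destruct (excluded_middle_informative (spectrum A (RtoC k))) as [Hs'|_];
      [now destruct Hs|reflexivity]. }
  destruct (resolvent_spec Hs) as (_ & _ & Hr).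
  assert (Hu0 : u = zero).
  { rewrite -(Hr u) Hu (linear_zero A HA); module_eq X; ring. }
  symmetry; apply minus_eq_0; exact Hu0.
Qed.

End RieszProjection.

(** * The index of a part of a cycle *)

Section SeparatedIndex.

Let W := C_CompleteNormedModule.

(** Here [chi] is the indicator of [P] along the arcs.  The function [F] is the
    integral of [chi / (z - w)] for [w] away from [P], and of [(chi - 1) / (z - w)]
    for [w] near [P], hence away from [Q].  The difference of the two integrals is
    the index of [w], which is zero at the points lying neither in [P] nor in
    [Q]; the change of definition takes place among such points. *)
Lemma separated_index (L : list (R -> C)) (chi : C -> C) (P Q : C -> Prop) (delta : R) :
  List.Forall C1_arc L -> continuous_along (V := W) L chi -> 0 < delta ->
  (forall z w, P z -> Q w -> delta <= Cmod (z - w)) ->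
  (forall z, on_arcs L z -> (P z /\ chi z = RtoC 1) \/ (Q z /\ chi z = RtoC 0)) ->
  (forall w, ~ P w -> ~ Q w -> index_integral L w = RtoC 0) ->
  forall w, Q w -> cauchy_integral (V := W) L chi w = RtoC 0.
Proof.
  intros HL Hchi Hdelta Hsep Hval Hout.
  (* Half the distance of [P] and [Q]: points near [P] are far from [Q]. *)
  set (near := fun w => exists z, P z /\ Cmod (z - w) < delta / 2).
  set (chi' := fun z => (chi z - RtoC 1)%C).
  assert (Hone := @continuous_along_const W L (RtoC 1)).
  assert (Hchi' : continuous_along (V := W) L chi').
  { intros g t Hin; apply (continuous_Cplus (f := fun s => chi (g (clamp s)))
      (g := fun _ => (- RtoC 1)%C)); [now apply Hchi|apply continuous_const]. }
  assert (Hsplit : forall w d, 0 < d -> supported_off (V := W) L chi w d ->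
    supported_off (V := W) L chi' w d -> index_integral L w = RtoC 0 ->
    cauchy_integral (V := W) L chi' w = cauchy_integral (V := W) L chi w).
  { intros w d Hd H1 H2 H0.
    assert (H3 : supported_off (V := W) L (fun _ => RtoC 1) w d).
    { intros z Hz; destruct (H1 z Hz) as [E1|E1]; [|now right].
      destruct (H2 z Hz) as [E2|E2]; [|now right].
      exfalso; apply C1_nz.
      change (chi z = RtoC 0) in E1; change (chi z - RtoC 1 = RtoC 0)%C in E2.
      rewrite E1 in E2; replace (RtoC 1) with (- (RtoC 0 - RtoC 1))%C by ring.
      rewrite E2; ring. }
    assert (Hsum : plus (cauchy_integral (V := W) L chi' w) (index_integral L w : W)
                   = cauchy_integral (V := W) L chi w).
    { unfold cauchy_integral, index_integral.
      rewrite -(arcs_integral_plus (V := W) HL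
        (continuous_along_cauchy (V := W) HL Hd Hchi' H2)
        (continuous_along_cauchy (V := W) HL Hd Hone H3)).
      apply (arcs_integral_ext (V := W)); intros z _.
      change (@eq C (/ (z - w) * (chi z - RtoC 1) + / (z - w) * RtoC 1)%C
                (/ (z - w) * chi z)%C); ring. }
    rewrite -Hsum H0; exact (eq_sym (Cplus_0_r _)). }
  set (F := fun w => match excluded_middle_informative (near w) with
    | left _ => cauchy_integral (V := W) L chi' w
    | right _ => cauchy_integral (V := W) L chi w
    end).
  assert (Hfarchi : forall w d, (forall z, P z -> d <= Cmod (z - w)) ->
            supported_off (V := W) L chi w d).
  { intros w d H z Hz; destruct (Hval z Hz) as [[HP _]|[_ H0]];
      [right; now apply H|left; exact H0]. }
  assert (Hnearchi : forall w, near w -> supported_off (V := W) L chi' w (delta / 2)).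
  { intros w (p & Hp & Hpw) z Hz; destruct (Hval z Hz) as [[_ H1]|[HQ _]].
    - left; unfold chi'; rewrite H1; exact (Cplus_opp_r _).
    - right; specialize (Hsep p z Hp HQ).
      assert (H := Cmod_triangle (p - w) (- (z - w))).
      replace (p - w + - (z - w))%C with (p - z)%C in H by ring.
      rewrite Cmod_opp in H; lra. }
  assert (HF : forall w, F w = (zero : W)).
  { apply (liouville (V := W)).
    - intros w; destruct (excluded_middle_informative (near w)) as [Hn|Hn].
      + destruct Hn as (p & Hp & Hpw).
        assert (Hd : 0 < delta / 2 - Cmod (p - w)) by lra.
        apply (taylor2_ext_loc (V := W) (G := cauchy_integral (V := W) L chi') Hd).
        * intros h Hh; unfold F.
          destruct (excluded_middle_informative (near (w + h)%C)) as [_|Hn];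
            [reflexivity|].
          exfalso; apply Hn; exists p; split; [exact Hp|].
          assert (H := Cmod_sub_shift p (w + h)%C (- h)%C).
          replace (w + h + - h)%C with w in H by ring; rewrite Cmod_opp in H; lra.
        * apply (cauchy_taylor2 (V := W) HL (d := delta / 2)); [lra|exact Hchi'|].
          apply Hnearchi; now exists p.
      + assert (Hfar : forall z, P z -> delta / 2 <= Cmod (z - w)).
        { intros z Hz; apply Rnot_lt_le; intros H; apply Hn; now exists z. }
        assert (Hd : 0 < delta / 4) by lra.
        apply (taylor2_ext_loc (V := W) (G := cauchy_integral (V := W) L chi) Hd).
        * intros h Hh; unfold F.
          destruct (excluded_middle_informative (near (w + h)%C)) as [Hn'|_];
            [|reflexivity].
          assert (Hs : forall z, P z -> delta / 4 <= Cmod (z - (w + h))).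
          { intros z Hz; specialize (Hfar z Hz); generalize (Cmod_sub_shift z w h); lra. }
          apply (Hsplit _ (delta / 4)); [lra|now apply Hfarchi| |].
          -- intros z Hz; destruct (Hnearchi _ Hn' z Hz) as [H|H]; [now left|right; lra].
          -- apply Hout.
             ++ intros HP; specialize (Hs _ HP).
                replace (w + h - (w + h))%C with (RtoC 0) in Hs by ring.
                rewrite Cmod_0 in Hs; lra.
             ++ intros HQ; destruct Hn' as (p & Hp & Hpw).
                specialize (Hsep _ _ Hp HQ); lra.
        * apply (cauchy_taylor2 (V := W) HL (d := delta / 2)); [lra|exact Hchi|].
          now apply Hfarchi.
    - intros e He.
      destruct (cauchy_vanishes (V := W) HL Hchi He) as [r1 H1].
      destruct (cauchy_vanishes (V := W) HL Hchi' He) as [r2 H2].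
      exists (Rmax r1 r2); intros w Hw; unfold F.
      destruct (excluded_middle_informative (near w)).
      + apply H2; eapply Rle_trans; [apply Rmax_r|exact Hw].
      + apply H1; eapply Rle_trans; [apply Rmax_l|exact Hw]. }
  intros w HQ; transitivity (F w); [unfold F|exact (HF w)].
  destruct (excluded_middle_informative (near w)) as [(p & Hp & Hpw)|_]; [|reflexivity].
  specialize (Hsep _ _ Hp HQ); lra.
Qed.

End SeparatedIndex.

(** * The resolvent of the block operator *)

Lemma minus_direct_sum (X Y : CompleteNormedModule C_AbsRing) (u v : direct_sum X Y) :
  minus u v = (minus (fst u) (fst v), minus (snd u) (snd v)).
Proof. reflexivity. Qed.

Lemma is_linear_add (X Y : CompleteNormedModule C_AbsRing) (l l' : X -> Y) :
  is_linear l -> is_linear l' -> is_linear (fun x => plus (l x) (l' x)).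
Proof.
  intros Hl Hl'.
  exact (is_linear_comp _ _ (is_linear_prod _ _ Hl Hl')
           (is_linear_plus (K := C_AbsRing) (V := Y))).
Qed.

Section BlockResolvent.

Variables X Y : CompleteNormedModule C_AbsRing.
Variables (A : X -> X) (B : Y -> Y) (C0 S : Y -> X).
Hypotheses (HA : is_linear A) (HB : is_linear B) (HC : is_linear C0).
Hypothesis HS : sylvester_solution A B C0 S.

Let M := upper_triangular A C0 B.
Let Z := direct_sum X Y.

Lemma is_linear_inl : is_linear (V := Z) (fun x : X => (x, zero) : Z).
Proof.
  exact (is_linear_prod (K := C_AbsRing) (T := X) (U := X) (V := Y) _ _
    (is_linear_id (K := C_AbsRing)) (is_linear_zero (K := C_AbsRing))).
Qed.

Lemma is_linear_graph : is_linear (V := Z) (fun y : Y => (opp (S y), y) : Z).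
Proof.
  exact (is_linear_prod (K := C_AbsRing) (T := Y) (U := X) (V := Y) _ _
    (is_linear_comp _ _ (proj1 HS) (is_linear_opp (K := C_AbsRing)))
    (is_linear_id (K := C_AbsRing))).
Qed.

(** In the basis where [M] is diagonal, its resolvent [T] has the diagonal block
    [x |-> x'], where [(x', _) = U T U^-1 (x, 0)] and [U (x, y) = (x + S y, y)].
    The same change of basis is used in [block_resolvent_B]. *)
Lemma block_resolvent_A (z : C) (T : Z -> Z) :
  is_resolvent M z T ->
  is_resolvent A z (fun x => plus (fst (T (x, zero))) (S (snd (T (x, zero))))).
Proof.
  intros (HT & Hl & Hr); destruct HS as [HSl HSe].
  assert (HTi := is_linear_comp _ _ is_linear_inl HT).
  split; [|split].
  - apply is_linear_add.
    + exact (is_linear_comp _ _ HTi (is_linear_fst (U := X) (V := Y))).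
    + exact (is_linear_comp _ _
        (is_linear_comp _ _ HTi (is_linear_snd (U := X) (V := Y))) HSl).
  - intros v.
    assert (E : T (minus (scal (z : C_AbsRing) v) (A v), zero) = (v, zero)).
    { rewrite -[RHS](Hl ((v, zero) : Z)); f_equal.
      unfold M, upper_triangular; rewrite minus_direct_sum; simpl.
      rewrite (linear_zero C0 HC) (linear_zero B HB); apply f_equal2.
      - change (minus (scal (z : C_AbsRing) v) (A v) =
                minus (scal (z : C_AbsRing) v) (plus (A v) zero)); module_eq X; ring.
      - change (zero = minus (scal (z : C_AbsRing) (zero : Y)) zero).
        module_eq Y. }
    change ((fun t : Z => plus (fst t) (S (snd t)))
              (T (minus (scal (z : C_AbsRing) v) (A v), zero)) = v).
    rewrite E; simpl; rewrite (linear_zero S HSl); module_eq X; ring.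
  - intros v; assert (Hv := Hr (v, zero)).
    set (t := T (v, zero)) in *; destruct t as [a b].
    rewrite minus_direct_sum in Hv; simpl in Hv; injection Hv as Ha Hb; simpl.
    change (minus (scal (z : C_AbsRing) a) (plus (A a) (C0 b)) = v) in Ha.
    change (minus (scal (z : C_AbsRing) b) (B b) = zero) in Hb.
    rewrite -[RHS]Ha -(HSe b) (linear_plus A HA).
    transitivity (plus (minus (scal (z : C_AbsRing) a)
      (plus (A a) (minus (A (S b)) (S (B b)))))
      (S (minus (scal (z : C_AbsRing) b) (B b)))).
    + rewrite (linear_minus S _ _ HSl) (linear_scal S HSl); module_eq X; ring.
    + rewrite Hb (linear_zero S HSl); module_eq X; ring.
Qed.

Lemma block_resolvent_B (z : C) (T : Z -> Z) :
  is_resolvent M z T -> is_resolvent B z (fun y => snd (T (opp (S y), y))).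
Proof.
  intros (HT & Hl & Hr); destruct HS as [HSl HSe].
  split; [|split].
  - exact (is_linear_comp _ _ (is_linear_comp _ _ is_linear_graph HT)
             (is_linear_snd (U := X) (V := Y))).
  - intros v.
    assert (E : T (opp (S (minus (scal (z : C_AbsRing) v) (B v))),
                   minus (scal (z : C_AbsRing) v) (B v)) = (opp (S v), v)).
    { rewrite -[RHS](Hl ((opp (S v), v) : Z)); f_equal.
      unfold M, upper_triangular; rewrite minus_direct_sum; apply f_equal2; [|reflexivity].
      simpl.
      change (opp (S (minus (scal (z : C_AbsRing) v) (B v))) =
        minus (scal (z : C_AbsRing) (opp (S v))) (plus (A (opp (S v))) (C0 v))).
      rewrite -(HSe v) (linear_opp A _ HA) (linear_minus S _ _ HSl) (linear_scal S HSl).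
      module_eq X; ring. }
    exact (f_equal snd E).
  - intros v; assert (Hv := Hr (opp (S v), v)).
    exact (f_equal snd Hv).
Qed.

Lemma block_spectrum (z : C) : ~ spectrum M z -> ~ spectrum A z /\ ~ spectrum B z.
Proof.
  intros Hz; assert (H := resolvent_spec Hz); split; intros H'; apply H';
    eexists; [apply (block_resolvent_A H)|apply (block_resolvent_B H)].
Qed.

(** The vector on the right, completed by [resolvent B z y], is the image of
    [(0, y)] under [U^-1 D U], where [D] is the diagonal operator of the resolvents
    and [U (x, y) = (x + S y, y)]. *)
Lemma block_resolvent_corner (z : C) (y : Y) :
  ~ spectrum M z ->
  fst (resolvent M z ((zero, y) : Z)) =
  minus (resolvent A z (S y)) (S (resolvent B z y)).
Proof.
  intros Hz; destruct (block_spectrum Hz) as [HzA HzB].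
  destruct (resolvent_spec Hz) as (_ & Hl & _).
  destruct (resolvent_spec HzA) as (_ & _ & HA2).
  destruct (resolvent_spec HzB) as (_ & _ & HB2).
  destruct HS as [HSl HSe].
  set (a := resolvent A z (S y)) in *; set (b := resolvent B z y) in *.
  assert (Ha : minus (scal (z : C_AbsRing) a) (A a) = S y) by apply HA2.
  assert (Hb : minus (scal (z : C_AbsRing) b) (B b) = y) by apply HB2.
  assert (Hv : minus (scal (z : C_AbsRing) ((minus a (S b), b) : Z))
                 (M ((minus a (S b), b) : Z)) = (zero, y)).
  { unfold M, upper_triangular; rewrite minus_direct_sum; apply f_equal2; [|exact Hb].
    simpl.
    change (minus (scal (z : C_AbsRing) (minus a (S b)))
              (plus (A (minus a (S b))) (C0 b)) = zero).
    rewrite -(HSe b) (linear_minus A _ _ HA).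
    transitivity (minus (minus (scal (z : C_AbsRing) a) (A a))
       (minus (scal (z : C_AbsRing) (S b)) (S (B b)))); [module_eq X; ring|].
    rewrite Ha -(linear_scal S HSl) -(linear_minus S _ _ HSl) Hb.
    module_eq X; ring. }
  rewrite -Hv Hl; reflexivity.
Qed.

End BlockResolvent.

(** * The index around the spectrum *)

(** The continuous function [1 / (z - a)] is bounded along the arcs. *)
Lemma off_arcs_distance (L : list (R -> C)) (a : C) :
  List.Forall C1_arc L -> ~ on_arcs L a ->
  exists d, 0 < d /\ forall z, on_arcs L z -> d <= Cmod (z - a).
Proof.
  intros HL Ha.
  assert (H0 : forall z, on_arcs L z -> (z - a)%C <> RtoC 0).
  { intros z Hz; apply Csub_neq_0; intros <-; exact (Ha Hz). }
  destruct (@continuous_along_bounded C_CompleteNormedModule L (fun z => / (z - a))%C)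
    as (M & HM & H).
  { intros g t Hin.
    apply (continuous_Cinv (g := fun s => (g (clamp s) - a)%C)).
    - apply H0; exists g, (clamp t); auto using clamp_range.
    - apply (continuous_Cplus (f := fun s => g (clamp s)) (g := fun _ => (- a)%C)).
      + apply C1_arc_continuous; exact (proj1 (List.Forall_forall _ _) HL g Hin).
      + apply continuous_const. }
  exists (/ (M + 1)); split; [apply Rinv_0_lt_compat; lra|]; intros z Hz.
  specialize (H z Hz); change (Cmod (/ (z - a)) <= M) in H.
  rewrite (Cmod_inv _ (H0 z Hz)) in H.
  assert (Hp := proj1 (Cmod_gt_0 _) (H0 z Hz)).
  rewrite -(Rinv_inv (Cmod (z - a))); apply Rinv_le_contravar; [|lra].
  now apply Rinv_0_lt_compat.
Qed.

Lemma index_winding (G : list (list (R -> C))) (a : C) :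
  index_integral (concat G) a = (winding_number G a * (RtoC (2 * PI) * Ci))%C.
Proof.
  unfold winding_number.
  transitivity (cycle_integral (V := C_CompleteNormedModule) G (fun z => / (z - a))%C).
  - apply (arcs_integral_ext (V := C_CompleteNormedModule)); intros z _.
    exact (Cmult_1_r _).
  - set (I := cycle_integral (V := C_CompleteNormedModule) G (fun z => / (z - a))%C : C).
    change (@eq C I (I / (RtoC (2 * PI) * Ci) * (RtoC (2 * PI) * Ci))%C).
    field; split; [exact Ci_nz|].
    intros H; apply two_pi_i_neq_0; rewrite H; ring.
Qed.

Lemma cauchy_integral_affine (L : list (R -> C)) (psi f g : C -> C) (a b c w : C) (d : R) :
  List.Forall C1_arc L -> 0 < d -> (forall z, on_arcs L z -> d <= Cmod (z - w)) ->
  continuous_along (V := C_CompleteNormedModule) L f ->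
  continuous_along (V := C_CompleteNormedModule) L g ->
  (forall z, on_arcs L z -> psi z = (a + b * f z + c * g z)%C) ->
  cauchy_integral (V := C_CompleteNormedModule) L psi w =
  (a * index_integral L w
   + b * cauchy_integral (V := C_CompleteNormedModule) L f w
   + c * cauchy_integral (V := C_CompleteNormedModule) L g w)%C.
Proof.
  intros HL Hd Hdist Hf Hg Heq.
  set (W := C_CompleteNormedModule) in *.
  assert (Hker : forall k : C -> C, continuous_along (V := W) L k ->
    continuous_along (V := W) L (fun z => scal (/ (z - w) : C_AbsRing)%C (k z : W))).
  { intros k Hk; apply (continuous_along_cauchy (V := W) HL Hd Hk).
    intros z Hz; right; auto. }
  assert (H1 := Hker _ (@continuous_along_const W L (RtoC 1))).
  assert (H2 := Hker _ Hf); assert (H3 := Hker _ Hg).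
  assert (S1 := continuous_along_linear (is_linear_scal W a) H1).
  assert (S2 := continuous_along_linear (is_linear_scal W b) H2).
  assert (S3 := continuous_along_linear (is_linear_scal W c) H3).
  simpl in S1, S2, S3.
  unfold index_integral, cauchy_integral.
  transitivity (plus (plus
    (scal (a : C_AbsRing) (arcs_integral (V := W) L (fun z => scal (/ (z - w) : C_AbsRing)%C (RtoC 1 : W))))
    (scal (b : C_AbsRing) (arcs_integral (V := W) L (fun z => scal (/ (z - w) : C_AbsRing)%C (f z : W)))))
    (scal (c : C_AbsRing) (arcs_integral (V := W) L (fun z => scal (/ (z - w) : C_AbsRing)%C (g z : W)))));
    [|reflexivity].
  rewrite -(arcs_integral_scal a HL H1) -(arcs_integral_scal b HL H2)
    -(arcs_integral_scal c HL H3).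
  rewrite -(arcs_integral_plus HL S1 S2)
    -(arcs_integral_plus HL (continuous_along_plus S1 S2) S3).
  apply (arcs_integral_ext (V := W)); intros z Hz; rewrite (Heq z Hz).
  change (@eq C (/ (z - w) * (a + b * f z + c * g z))%C
    (a * (/ (z - w) * RtoC 1) + b * (/ (z - w) * f z) + c * (/ (z - w) * g z))%C); ring.
Qed.

Lemma set_dist_le (S T : C -> Prop) (e : R) (z w : C) :
  Rbar_le e (set_dist S T) -> S z -> T w -> e <= Cmod (z - w).
Proof.
  intros H Hz Hw; unfold set_dist in H.
  destruct (Glb_Rbar_correct (fun d => exists z w, S z /\ T w /\ d = Cmod (z - w)))
    as [Hlb _].
  exact (Rbar_le_trans _ _ _ H (Hlb (Cmod (z - w))
           (ex_intro _ z (ex_intro _ w (conj Hz (conj Hw eq_refl)))))).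
Qed.

Lemma locally_Cmod (z : C) (P : C -> Prop) :
  @locally C_UniformSpace z P ->
  exists d, 0 < d /\ forall h, Cmod h < d -> P (z + h)%C.
Proof.
  intros H.
  destruct (locally_norm_le_locally (K := C_AbsRing) (V := C_NormedModule) z P H)
    as [d Hd].
  exists d; split; [apply cond_pos|]; intros h Hh; apply Hd.
  change (Cmod (z + h - z) < d).
  now replace (z + h - z)%C with h by ring.
Qed.

Lemma continuous_along_holomorphic (L : list (R -> C)) (D : C -> Prop) (psi : C -> C) :
  List.Forall C1_arc L -> (forall z, on_arcs L z -> D z) -> holomorphic_on D psi ->
  continuous_along (V := C_CompleteNormedModule) L psi.
Proof.
  intros HL HD Hpsi g t Hin.
  assert (Hc : @continuous C_UniformSpace C_UniformSpace psi (g (clamp t))).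
  { intros P HP; apply locally_C.
    refine (ex_derive_continuous (K := C_AbsRing) (V := C_NormedModule) psi _ _ P HP).
    apply Hpsi, HD; exists g, (clamp t); auto using clamp_range. }
  apply (continuous_comp (fun s => g (clamp s)) psi); [|exact Hc].
  apply C1_arc_continuous; exact (proj1 (List.Forall_forall _ _) HL g Hin).
Qed.

(** * The upper right corner of the functional calculus *)

Theorem proposition4p2
  (X Y : CompleteNormedModule C_AbsRing)
  (A : X -> X) (B : Y -> Y) (C0 : Y -> X)
  (hA : is_linear A) (hB : is_linear B) (hC : is_linear C0)
  (hAB : forall z, ~ (spectrum A z /\ spectrum B z))
  (eps : R) (heps : 0 < eps)
  (heps_dist : Rbar_lt eps (Rbar_div (set_dist (spectrum A) (spectrum B)) 2))
  (p q : cpoly)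
  (hpq : no_common_root p q)
  (hp : has_distinct_roots p)
  (hdeg : (deg q < deg p)%nat)
  (V1 V2 V0 : C -> Prop)
  (hV : forall z, sublevel1 p q z <-> V1 z \/ V2 z \/ V0 z)
  (hdisj12 : forall z, ~ (V1 z /\ V2 z))
  (hdisj10 : forall z, ~ (V1 z /\ V0 z))
  (hdisj20 : forall z, ~ (V2 z /\ V0 z))
  (hV1 : union_of_components (sublevel1 p q) V1)
  (hV2 : union_of_components (sublevel1 p q) V2)
  (hV0 : union_of_components (sublevel1 p q) V0)
  (hA_V1 : inside_interior (spectrum A) V1)
  (hB_V2 : inside_interior (spectrum B) V2)
  (hM_V0 : forall z, ~ (V0 z /\ spectrum (upper_triangular A C0 B) z))
  (hdist12 : Rbar_le (eps / 2) (set_dist V1 V2))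
  (hdist10 : Rbar_le (eps / 2) (set_dist V1 V0))
  (hdist20 : Rbar_le (eps / 2) (set_dist V2 V0))
  (psi : C -> C)
  (hpsi : holomorphic_on (sublevel1 p q) psi)
  (hpsi1 : forall z, V1 z -> psi z = RtoC 1)
  (hpsi2 : forall z, V2 z -> psi z = RtoC (-1))
  (hpsi0 : forall z, V0 z -> psi z = RtoC 0)
  (psiM : direct_sum X Y -> direct_sum X Y)
  (hpsiM : is_functional_calculus (sublevel1 p q) psi
             (upper_triangular A C0 B) psiM)
  (S : Y -> X) (hS : sylvester_solution A B C0 S) :
  forall y : Y, upper_right_corner psiM y = scal (RtoC 2 : C_AbsRing) (S y).
Proof.
  intros y.
  destruct hpsiM as (G & (HG & Htr & Hw1 & Hw0) & HT).
  set (M := upper_triangular A C0 B) in *.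
  set (L := concat G); set (W := C_CompleteNormedModule).
  set (tpi := (RtoC (2 * PI) * Ci)%C).
  assert (Htpi : tpi <> RtoC 0) by exact two_pi_i_neq_0.
  assert (HL : List.Forall C1_arc L) by exact (cycle_C1_arcs HG).
  assert (HLV : forall z, on_arcs L z -> sublevel1 p q z) by (intros z Hz; apply Htr, Hz).
  assert (HLM : forall z, on_arcs L z -> ~ spectrum M z) by (intros z Hz; apply Htr, Hz).
  assert (Hspec : forall z, ~ spectrum M z -> ~ spectrum A z /\ ~ spectrum B z)
    by (intros z; now apply (block_spectrum hA hB hC hS)).
  assert (Hpsi : continuous_along (V := W) L psi)
    by exact (continuous_along_holomorphic HL HLV hpsi).
  (* The indicators of [V1], [V2] and [V0] on the domain, written as polynomials in
     [psi] so that their continuity along the cycle is that of [psi]. *)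
  set (chi1 := fun z => (RtoC (/ 2) * (psi z * psi z + psi z))%C).
  set (chi2 := fun z => (RtoC (/ 2) * (psi z * psi z + RtoC (-1) * psi z))%C).
  set (chi0 := fun z => (RtoC 1 + RtoC (-1) * (psi z * psi z))%C).
  assert (Hchi1 : continuous_along (V := W) L chi1).
  { intros g t Hin; assert (H := Hpsi g t Hin).
    apply continuous_Cmult; [apply continuous_const|].
    apply continuous_Cplus; [now apply continuous_Cmult|exact H]. }
  assert (Hchi2 : continuous_along (V := W) L chi2).
  { intros g t Hin; assert (H := Hpsi g t Hin).
    apply continuous_Cmult; [apply continuous_const|].
    apply continuous_Cplus; [now apply continuous_Cmult|].
    apply continuous_Cmult; [apply continuous_const|exact H]. }
  assert (Hchi0 : continuous_along (V := W) L chi0).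
  { intros g t Hin; assert (H := Hpsi g t Hin).
    apply continuous_Cplus; [apply continuous_const|].
    apply continuous_Cmult; [apply continuous_const|now apply continuous_Cmult]. }
  assert (Hval : forall z, on_arcs L z -> V1 z /\ psi z = RtoC 1 \/
     V2 z /\ psi z = RtoC (-1) \/ V0 z /\ psi z = RtoC 0).
  { intros z Hz; destruct (proj1 (hV z) (HLV z Hz)) as [H|[H|H]]; auto. }
  assert (Hout : forall w, ~ V1 w -> ~ V2 w -> ~ V0 w -> index_integral L w = RtoC 0).
  { intros w N1 N2 N0; unfold L; rewrite index_winding Hw0; [ring|].
    rewrite hV; tauto. }
  assert (Hsym : forall z w : C, Cmod (z - w) = Cmod (w - z)).
  { intros z w; rewrite -Cmod_opp; f_equal; ring. }
  assert (Hhalf : 0 < eps / 2) by lra.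
  assert (Hidx1 : forall w, V2 w \/ V0 w -> cauchy_integral (V := W) L chi1 w = RtoC 0).
  { apply (separated_index (P := V1) HL Hchi1 Hhalf).
    - intros z w Hz [H|H]; [exact (set_dist_le hdist12 Hz H)|exact (set_dist_le hdist10 Hz H)].
    - intros z Hz; unfold chi1; destruct (Hval z Hz) as [[H E]|[[H E]|[H E]]]; rewrite E.
      + left; split; [exact H|]; apply injective_projections; simpl; field.
      + right; split; [tauto|]; apply injective_projections; simpl; field.
      + right; split; [tauto|]; apply injective_projections; simpl; field.
    - intros w H1 H2; apply Hout; tauto. }
  assert (Hidx2 : forall w, V1 w \/ V0 w -> cauchy_integral (V := W) L chi2 w = RtoC 0).
  { apply (separated_index (P := V2) HL Hchi2 Hhalf).
    - intros z w Hz [H|H];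
        [rewrite Hsym; exact (set_dist_le hdist12 H Hz)|exact (set_dist_le hdist20 Hz H)].
    - intros z Hz; unfold chi2; destruct (Hval z Hz) as [[H E]|[[H E]|[H E]]]; rewrite E.
      + right; split; [tauto|]; apply injective_projections; simpl; field.
      + left; split; [exact H|]; apply injective_projections; simpl; field.
      + right; split; [tauto|]; apply injective_projections; simpl; field.
    - intros w H1 H2; apply Hout; tauto. }
  assert (Hidx0 : forall w, V1 w \/ V2 w -> cauchy_integral (V := W) L chi0 w = RtoC 0).
  { apply (separated_index (P := V0) HL Hchi0 Hhalf).
    - intros z w Hz [H|H]; rewrite Hsym;
        [exact (set_dist_le hdist10 H Hz)|exact (set_dist_le hdist20 H Hz)].
    - intros z Hz; unfold chi0; destruct (Hval z Hz) as [[H E]|[[H E]|[H E]]]; rewrite E.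
      + right; split; [tauto|]; apply injective_projections; simpl; field.
      + right; split; [tauto|]; apply injective_projections; simpl; field.
      + left; split; [exact H|]; apply injective_projections; simpl; field.
    - intros w H1 H2; apply Hout; tauto. }
  (* The winding number is prescribed on [spectrum M] itself; being locally
     constant, it keeps the value [1] nearby. *)
  assert (Hnear : forall (V' : C -> Prop) a, spectrum M a -> @locally C_UniformSpace a V' ->
    exists d, 0 < d /\ (forall z, on_arcs L z -> d <= Cmod (z - a)) /\
      forall h, Cmod h < d / 2 -> V' (a + h)%C /\ index_integral L (a + h)%C = tpi /\
        (forall z, on_arcs L z -> d / 2 <= Cmod (z - (a + h)))).
  { intros V' a Ha HV'.
    destruct (locally_Cmod HV') as (d1 & Hd1 & H1).
    destruct (off_arcs_distance (a := a) HL) as (d2 & Hd2 & H2).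
    { intros H; exact (HLM a H Ha). }
    assert (Hmin : 0 < Rmin d1 d2) by now apply Rmin_pos.
    assert (Hm1 := Rmin_l d1 d2); assert (Hm2 := Rmin_r d1 d2).
    set (d := Rmin d1 d2) in *.
    assert (Hdist : forall z, on_arcs L z -> d <= Cmod (z - a)).
    { intros z Hz; specialize (H2 z Hz); lra. }
    exists d; split; [exact Hmin|split; [exact Hdist|]]; intros h Hh; split; [|split].
    - apply H1; lra.
    - unfold L; rewrite (index_locally_constant HG Hmin Hdist Hh).
      rewrite index_winding (Hw1 a Ha); fold tpi; ring.
    - intros z Hz; specialize (Hdist z Hz).
      assert (H := Cmod_sub_shift z a h); lra. }
  assert (HIA : arcs_integral L (fun z => scal (psi z : C_AbsRing) (resolvent A z (S y)))
                = scal (tpi : C_AbsRing) (S y)).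
  { apply (riesz_integral hA (S y) HL Hpsi).
    - intros z Hz; exact (proj1 (Hspec z (HLM z Hz))).
    - intros a Ha.
      assert (HaM : spectrum M a)
        by (apply NNPP; intros H; exact (proj1 (Hspec a H) Ha)).
      destruct (Hnear V1 a HaM (hA_V1 a Ha)) as (d & Hd & Hdist & H).
      exists (d / 2); split; [lra|split].
      + intros z Hz; specialize (Hdist z Hz); lra.
      + intros h Hh; destruct (H h Hh) as (HV1 & Hind & Hdist').
        (* [psi = 1 - 2 chi2 - chi0], and [chi2], [chi0] do not contribute in [V1] *)
        assert (Hdec : forall z, on_arcs L z ->
          psi z = (RtoC 1 + RtoC (-2) * chi2 z + RtoC (-1) * chi0 z)%C).
        { intros z _; unfold chi2, chi0; apply injective_projections; simpl; field. }
        assert (Hd2 : 0 < d / 2) by lra.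
        rewrite (cauchy_integral_affine HL Hd2 Hdist' Hchi2 Hchi0 Hdec).
        rewrite Hind (Hidx2 _ (or_introl HV1)) (Hidx0 _ (or_introl HV1)).
        match goal with |- ?u = ?v => change (@eq C u v) end; ring. }
  assert (HIB : arcs_integral L (fun z => scal (psi z : C_AbsRing) (resolvent B z y))
                = scal (- tpi : C_AbsRing)%C y).
  { apply (riesz_integral hB y HL Hpsi).
    - intros z Hz; exact (proj2 (Hspec z (HLM z Hz))).
    - intros a Ha.
      assert (HaM : spectrum M a)
        by (apply NNPP; intros H; exact (proj2 (Hspec a H) Ha)).
      destruct (Hnear V2 a HaM (hB_V2 a Ha)) as (d & Hd & Hdist & H).
      exists (d / 2); split; [lra|split].
      + intros z Hz; specialize (Hdist z Hz); lra.
      + intros h Hh; destruct (H h Hh) as (HV2 & Hind & Hdist').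
        (* [psi = - 1 + 2 chi1 + chi0], and [chi1], [chi0] do not contribute in [V2] *)
        assert (Hdec : forall z, on_arcs L z ->
          psi z = (RtoC (-1) + RtoC 2 * chi1 z + RtoC 1 * chi0 z)%C).
        { intros z _; unfold chi1, chi0; apply injective_projections; simpl; field. }
        assert (Hd2 : 0 < d / 2) by lra.
        rewrite (cauchy_integral_affine HL Hd2 Hdist' Hchi1 Hchi0 Hdec).
        rewrite Hind (Hidx1 _ (or_introl HV2)) (Hidx0 _ (or_intror HV2)).
        match goal with |- ?u = ?v => change (@eq C u v) end; ring. }
  assert (HSl := proj1 hS).
  assert (HRM : continuous_along L (fun z =>
    scal (psi z : C_AbsRing) (resolvent M z ((zero, y) : direct_sum X Y))))
    by (apply continuous_along_scal; [exact Hpsi|now apply continuous_along_resolvent]).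
  assert (HRA : continuous_along L (fun z => scal (psi z : C_AbsRing) (resolvent A z (S y)))).
  { apply continuous_along_scal; [exact Hpsi|apply (continuous_along_resolvent HL)].
    intros z Hz; exact (proj1 (Hspec z (HLM z Hz))). }
  assert (HRB : continuous_along L (fun z => scal (psi z : C_AbsRing) (resolvent B z y))).
  { apply continuous_along_scal; [exact Hpsi|apply (continuous_along_resolvent HL)].
    intros z Hz; exact (proj2 (Hspec z (HLM z Hz))). }
  assert (HlB : is_linear (fun u : Y => scal (RtoC (-1) : C_AbsRing) (S u)))
    by exact (is_linear_comp _ _ HSl (is_linear_scal X (RtoC (-1)))).
  unfold upper_right_corner; rewrite HT.
  change (scal (/ tpi : C_AbsRing)%C (fst (arcs_integral L (fun z =>
    scal (psi z : C_AbsRing) (resolvent M z ((zero, y) : direct_sum X Y))))) =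
    scal (RtoC 2 : C_AbsRing) (S y)).
  assert (Hfst : is_linear (U := direct_sum X Y) (V := X) (fun v => fst v))
    by exact (is_linear_fst (U := X) (V := Y)).
  rewrite -(arcs_integral_linear Hfst HL HRM).
  replace (arcs_integral L (fun z => fst (scal (psi z : C_AbsRing)
             (resolvent M z ((zero, y) : direct_sum X Y)))))
    with (plus (arcs_integral L (fun z => scal (psi z : C_AbsRing) (resolvent A z (S y))))
      (arcs_integral L (fun z => scal (RtoC (-1) : C_AbsRing)
         (S (scal (psi z : C_AbsRing) (resolvent B z y)))))).
  - rewrite (arcs_integral_linear HlB HL HRB) HIA HIB (linear_scal S HSl).
    assert (E1 : RtoC (-1) = (- RtoC 1)%C) by (apply injective_projections; simpl; ring).
    assert (E2 : RtoC 2 = (RtoC 1 + RtoC 1)%C) by (apply injective_projections; simpl; ring).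
    rewrite E1 E2; module_eq X; field; exact Htpi.
  - rewrite -(arcs_integral_plus HL HRA (continuous_along_linear HlB HRB)).
    apply arcs_integral_ext; intros z Hz.
    change (fst (scal (psi z : C_AbsRing) (resolvent M z ((zero, y) : direct_sum X Y))))
      with (scal (psi z : C_AbsRing) (fst (resolvent M z ((zero, y) : direct_sum X Y)))).
    rewrite (block_resolvent_corner hA hB hC hS y (HLM z Hz)) (linear_scal S HSl).
    module_eq X; ring.
Qed.
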